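(* Let $G$ be a $\sigma$-compact locally compact Abelian group and $\Lambda\subset G$ relatively dense and period-stable. The following are equivalent: (i) $\Lambda$ is a model set; (ii) $\Lambda$ has finite local complexity and there is a nonzero positive sup-almost periodic discrete measure $\eta$ with $\eta\le\delta_\Lambda$; (iii) $\Lambda$ has finite local complexity and there is a nonzero positive norm-almost periodic discrete measure $\eta$ with $\eta\le\delta_\Lambda$; (iv) $\Lambda-\Lambda$ is uniformly discrete and there is a nonzero positive strongly almost periodic discrete measure $\eta$ with $\eta\le\delta_\Lambda$.
   Context: $\Lambda$ is period-stable if for every subgroup $H'\le G$ with $H'\subset\Lambda-\Lambda$ one has $H'+\Lambda=\Lambda$. $\delta_\Lambda=\sum_{x\in\Lambda}\delta_x$. Finite local complexity: $\Lambda-\Lambda$ locally finite. Fix compact $K$ with nonempty interior; $\|\mu\|_K=\sup_t|\mu|(t+K)$, $T_t\mu(A)=\mu(A-t)$. Norm-almost periodic: $\{t:\|\eta-T_t\eta\|_K<\varepsilon\}$ relatively dense for all $\varepsilon>0$; sup-almost periodic: $\{t:\sup_x|\eta(\{t+x\})-\eta(\{x\})|<\varepsilon\}$ relatively dense for all $\varepsilon>0$; strongly almost periodic: $f*\eta$ is a Bohr almost periodic function for every $f\in C_c(G)$. A model set is $\{x\in\pi_1(\widetilde L):x^\star\in W\}$ for a cut and project scheme $(G\times H,\widetilde L)$ ($H$ locally compact Abelian, $\widetilde L$ discrete cocompact subgroup of $G\times H$, $\pi_1|_{\widetilde L}$ injective, $\pi_2(\widetilde L)$ dense, $x^\star=\pi_2((\pi_1|_{\widetilde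 L})^{-1}(x))$) and $W\subset H$ precompact with nonempty interior. *)

(* Defs.v *)
From Stdlib Require Import Reals List Classical.
Open Scope R_scope.

Definition is_compact {X : Type} (op : (X -> Prop) -> Prop) (K : X -> Prop) : Prop :=
  forall F : (X -> Prop) -> Prop,
    (forall U, F U -> op U) ->
    (forall x, K x -> exists U, F U /\ U x) ->
    exists l : list (X -> Prop),
      (forall U, In U l -> F U) /\ (forall x, K x -> exists U, In U l /\ U x).

Definition closure {X : Type} (op : (X -> Prop) -> Prop) (A : X -> Prop) (x : X) : Prop :=
  forall U, op U -> U x -> exists y, U y /\ A y.

Record LCAGroup : Type := mkLCA {
  car :> Type;
  gzero : car;
  gadd : car -> car -> car;
  gopp : car -> car;
  gaddA : forall x y z, gadd x (gadd y z) = gadd (gadd x y) z;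
  gaddC : forall x y, gadd x y = gadd y x;
  gadd0 : forall x, gadd gzero x = x;
  gaddN : forall x, gadd (gopp x) x = gzero;
  gopen : (car -> Prop) -> Prop;
  gopen_full : gopen (fun _ => True);
  gopen_inter : forall U V, gopen U -> gopen V -> gopen (fun x => U x /\ V x);
  gopen_union : forall F : (car -> Prop) -> Prop,
      (forall U, F U -> gopen U) -> gopen (fun x => exists U, F U /\ U x);
  gadd_cont : forall x y U, gopen U -> U (gadd x y) ->
      exists V W, gopen V /\ gopen W /\ V x /\ W y /\
                  forall a b, V a -> W b -> U (gadd a b);
  gopp_cont : forall x U, gopen U -> U (gopp x) ->
      exists V, gopen V /\ V x /\ forall a, V a -> U (gopp a);
  ghausdorff : forall x y, x <> y ->
      exists U V, gopen U /\ gopen V /\ U x /\ V y /\ forall z, U z -> V z -> False;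
  glocally_compact : forall x,
      exists U K, gopen U /\ U x /\ (forall z, U z -> K z) /\ is_compact gopen K
}.

Arguments gzero {_}.
Arguments gadd {_} _ _.
Arguments gopp {_} _.

Definition gsub {G : LCAGroup} (x y : G) : G := gadd x (gopp y).

Definition sigma_compact (G : LCAGroup) : Prop :=
  exists Kn : nat -> G -> Prop,
    (forall n, is_compact (gopen G) (Kn n)) /\ forall x, exists n, Kn n x.

Definition has_nonempty_interior (G : LCAGroup) (K : G -> Prop) : Prop :=
  exists U, gopen G U /\ (exists x, U x) /\ forall x, U x -> K x.

Definition relatively_dense (G : LCAGroup) (A : G -> Prop) : Prop :=
  exists K, is_compact (gopen G) K /\
    forall g, exists a k, A a /\ K k /\ g = gadd a k.

Definition diffset (G : LCAGroup) (A : G -> Prop) (x : G) : Prop :=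
  exists a b, A a /\ A b /\ x = gsub a b.

Definition locally_finite (G : LCAGroup) (A : G -> Prop) : Prop :=
  forall K, is_compact (gopen G) K -> exists l : list G, forall x, A x -> K x -> In x l.

Definition uniformly_discrete (G : LCAGroup) (A : G -> Prop) : Prop :=
  exists U, gopen G U /\ U gzero /\
    forall x y, A x -> A y -> U (gsub x y) -> x = y.

Definition finite_local_complexity (G : LCAGroup) (A : G -> Prop) : Prop :=
  locally_finite G (diffset G A).

Definition subgroup (G : LCAGroup) (S : G -> Prop) : Prop :=
  S gzero /\ (forall x y, S x -> S y -> S (gadd x y)) /\ (forall x, S x -> S (gopp x)).

Definition period_stable (G : LCAGroup) (L : G -> Prop) : Prop :=
  forall S, subgroup G S -> (forall h, S h -> diffset G L h) ->
    (forall h x, S h -> L x -> L (gadd h x)) /\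
    (forall x, L x -> exists h y, S h /\ L y /\ x = gadd h y).

Definition continuous_fun (G : LCAGroup) (f : G -> R) : Prop :=
  forall x eps, 0 < eps ->
    exists U, gopen G U /\ U x /\ forall y, U y -> Rabs (f y - f x) < eps.

Definition compact_support (G : LCAGroup) (f : G -> R) : Prop :=
  exists K, is_compact (gopen G) K /\ forall x, ~ K x -> f x = 0.

Definition sup_lt {X : Type} (g : X -> R) (eps : R) : Prop :=
  exists e', e' < eps /\ forall x, Rabs (g x) <= e'.

Definition bohr_ap (G : LCAGroup) (F : G -> R) : Prop :=
  continuous_fun G F /\
  forall eps, 0 < eps ->
    relatively_dense G (fun t => sup_lt (fun x => F (gadd x t) - F x) eps).

Fixpoint lsum {X : Type} (a : X -> R) (l : list X) : R :=
  match l with nil => 0 | x :: l' => a x + lsum a l' end.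

Definition HasSum {X : Type} (a : X -> R) (s : R) : Prop :=
  forall eps, 0 < eps -> exists l0 : list X,
    forall l, NoDup l -> incl l0 l -> Rabs (lsum a l - s) < eps.

(* ---------- discrete measures eta <= delta_Lambda ----------
   A positive measure eta with eta <= delta_Lambda is pure point, given by
   its weights w x = eta({x}), with 0 <= w <= 1 on Lambda and w = 0 off Lambda. *)
Definition pos_measure_below_delta (G : LCAGroup) (L : G -> Prop) (w : G -> R) : Prop :=
  (forall x, 0 <= w x) /\ (forall x, L x -> w x <= 1) /\ (forall x, ~ L x -> w x = 0).

Definition nonzero_measure (G : LCAGroup) (w : G -> R) : Prop := exists x, w x <> 0.

(* ||mu||_K < eps, for the pure point (signed) measure with weights v:
   sup_s |mu|(s + K) < eps *)
Definition normK_lt (G : LCAGroup) (K : G -> Prop) (v : G -> R) (eps : R) : Prop :=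
  exists e', e' < eps /\
    forall (s : G) (l : list G), NoDup l -> (forall x, In x l -> K (gsub x s)) ->
      lsum (fun x => Rabs (v x)) l <= e'.

(* T_t eta ({x}) = eta({x - t}) *)
Definition norm_ap (G : LCAGroup) (K : G -> Prop) (w : G -> R) : Prop :=
  forall eps, 0 < eps ->
    relatively_dense G (fun t => normK_lt G K (fun x => w x - w (gsub x t)) eps).

Definition sup_ap (G : LCAGroup) (w : G -> R) : Prop :=
  forall eps, 0 < eps ->
    relatively_dense G (fun t => sup_lt (fun x => w (gadd t x) - w x) eps).

Definition strongly_ap (G : LCAGroup) (w : G -> R) : Prop :=
  forall f : G -> R, continuous_fun G f -> compact_support G f ->
    exists F : G -> R,
      (forall x, HasSum (fun y => f (gsub x y) * w y) (F x)) /\ bohr_ap G F.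

Definition prod_open (G H : LCAGroup) (O : (G * H)%type -> Prop) : Prop :=
  forall p, O p -> exists U V, gopen G U /\ gopen H V /\ U (fst p) /\ V (snd p) /\
    forall a b, U a -> V b -> O (a, b).

Definition model_set (G : LCAGroup) (L : G -> Prop) : Prop :=
  exists (H : LCAGroup) (Lt : (G * H)%type -> Prop) (W : H -> Prop),
    Lt (gzero, gzero) /\
    (forall p q, Lt p -> Lt q -> Lt (gadd (fst p) (fst q), gadd (snd p) (snd q))) /\
    (forall p, Lt p -> Lt (gopp (fst p), gopp (snd p))) /\
    (exists O, prod_open G H O /\ O (gzero, gzero) /\
       forall p, Lt p -> O p -> p = (gzero, gzero)) /\
    (exists C, is_compact (prod_open G H) C /\
       forall p, exists c q, C c /\ Lt q /\
         p = (gadd (fst c) (fst q), gadd (snd c) (snd q))) /\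
    (forall p q, Lt p -> Lt q -> fst p = fst q -> p = q) /\
    (forall V, gopen H V -> (exists h, V h) -> exists p, Lt p /\ V (snd p)) /\
    is_compact (gopen H) (closure (gopen H) W) /\
    has_nonempty_interior H W /\
    (forall x, L x <-> exists h, Lt (x, h) /\ W h).

(* Main.v *)
(** A model set with window [W] carries the weights [f h] at [x], for [(x, h)] in
    the lattice, where [f] is a uniformly continuous bump below the indicator of
    [W]; lattice points with small second component give almost periods.

    Conversely, let [w] be sup-almost periodic weights below [L].  An almost period
    [t] with error less than [w x0] moves [x0] inside [L], hence lies in [L - L],
    which is locally finite.  So in the sup-norm closure [H] of the translates of
    [w] small balls are totally bounded, [H] is a locally compact group, and the
    pairs [(x, T_x w)] with [x] ranging over all of [G] form a lattice in [G * H].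
    Two points with the same translate differ by a period of [w]; the periods form
    a subgroup inside [L - L], so by period-stability [L] is exactly the set of [x]
    with [T_x w] in the image of [L]. *)

Require Import Defs.
From Stdlib Require Import Reals List Classical Lra Lia Permutation Wf_nat.
From Stdlib Require Import ClassicalEpsilon FunctionalExtensionality.
From Stdlib Require Import PropExtensionality ProofIrrelevance ChoiceFacts.
Import ListNotations.
Open Scope R_scope.

(** * Identities in abelian groups *)

Inductive group_expr : Type :=
| EVar (n : nat) | EZero | EAdd (a b : group_expr) | EOpp (a : group_expr).

Section GroupExpressions.
Variables (G : LCAGroup) (env : list G).

Fixpoint eval_expr (e : group_expr) : G :=
  match e with
  | EVar n => nth n env gzero
  | EZero => gzero
  | EAdd a b => gadd (eval_expr a) (eval_expr b)
  | EOpp a => gopp (eval_expr a)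
  end.

Fixpoint signed_vars (e : group_expr) : list nat * list nat :=
  match e with
  | EVar n => ([n], [])
  | EZero => ([], [])
  | EAdd a b =>
    (fst (signed_vars a) ++ fst (signed_vars b), snd (signed_vars a) ++ snd (signed_vars b))
  | EOpp a => (snd (signed_vars a), fst (signed_vars a))
  end.

Definition sum_vars (l : list nat) : G :=
  fold_right (fun n sum => gadd (nth n env gzero) sum) gzero l.

Lemma gaddCA (x y z : G) : gadd x (gadd y z) = gadd y (gadd x z).
Proof. now rewrite gaddA, (gaddC G x y), <- gaddA. Qed.

Lemma gadd_cancel_l (x y z : G) : gadd x y = gadd x z -> y = z.
Proof.
intros E. rewrite <- (gadd0 G y), <- (gadd0 G z), <- (gaddN G x).
now rewrite <- !gaddA, E.
Qed.

Lemma sum_vars_app l m : sum_vars (l ++ m) = gadd (sum_vars l) (sum_vars m).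
Proof.
induction l as [|n l IH]; simpl; [now rewrite gadd0|].
now rewrite IH, gaddA.
Qed.

Lemma sum_vars_perm l m : Permutation l m -> sum_vars l = sum_vars m.
Proof.
induction 1; simpl; try congruence.
apply gaddCA.
Qed.

Lemma eval_signed_vars e :
  gadd (sum_vars (snd (signed_vars e))) (eval_expr e) = sum_vars (fst (signed_vars e)).
Proof.
induction e as [n| |a IHa b IHb|a IHa]; simpl.
- now rewrite gaddC, (gaddC G _ gzero).
- now rewrite gadd0.
- rewrite !sum_vars_app, <- IHa, <- IHb, <- !gaddA. f_equal. apply gaddCA.
- rewrite <- IHa, <- gaddA, (gaddC G (eval_expr a)), gaddN.
  now rewrite gaddC, gadd0.
Qed.

(* [a - b = c - d] is tested as the equality of the multisets [a + d] and [c + b]. *)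
Definition same_signed_vars (e1 e2 : group_expr) : bool :=
  let l := fst (signed_vars e1) ++ snd (signed_vars e2) in
  let m := fst (signed_vars e2) ++ snd (signed_vars e1) in
  forallb (fun n => Nat.eqb (count_occ Nat.eq_dec l n) (count_occ Nat.eq_dec m n)) (l ++ m).

Lemma eval_expr_eq e1 e2 : same_signed_vars e1 e2 = true -> eval_expr e1 = eval_expr e2.
Proof.
unfold same_signed_vars. set (l := _ ++ _). set (m := fst (signed_vars e2) ++ _).
intros same. rewrite forallb_forall in same.
assert (perm : Permutation l m).
{ apply (Permutation_count_occ Nat.eq_dec). intros n.
  destruct (in_dec Nat.eq_dec n (l ++ m)) as [In_n|notIn_n].
  - now apply Nat.eqb_eq, same.
  - rewrite in_app_iff in notIn_n.
    rewrite (proj1 (count_occ_not_In Nat.eq_dec l n)) by tauto.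
    now rewrite (proj1 (count_occ_not_In Nat.eq_dec m n)) by tauto. }
apply sum_vars_perm in perm. unfold l, m in perm.
rewrite !sum_vars_app, <- !eval_signed_vars in perm.
apply (gadd_cancel_l (gadd (sum_vars (snd (signed_vars e1))) (sum_vars (snd (signed_vars e2))))).
rewrite <- !gaddA, (gaddC G (sum_vars (snd (signed_vars e2))) (eval_expr e1)), gaddA, perm.
now rewrite (gaddC G _ (sum_vars (snd (signed_vars e1)))).
Qed.
End GroupExpressions.

Ltac list_mem x l :=
  lazymatch l with
  | nil => constr:(false)
  | cons x _ => constr:(true)
  | cons _ ?t => list_mem x t
  end.
Ltac list_index x l :=
  lazymatch l with
  | cons x _ => constr:(O)
  | cons _ ?t => let n := list_index x t in constr:(S n)
  end.
Ltac collect_vars t l :=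
  lazymatch t with
  | gadd ?a ?b => let l' := collect_vars a l in collect_vars b l'
  | gopp ?a => collect_vars a l
  | gzero => l
  | _ => match list_mem t l with true => l | false => constr:(cons t l) end
  end.
Ltac reify_expr t l :=
  lazymatch t with
  | gadd ?a ?b =>
    let a' := reify_expr a l in let b' := reify_expr b l in constr:(EAdd a' b')
  | gopp ?a => let a' := reify_expr a l in constr:(EOpp a')
  | gzero => constr:(EZero)
  | _ => let n := list_index t l in constr:(EVar n)
  end.
Ltac abel :=
  intros; unfold gsub;
  lazymatch goal with
  | |- @eq (car ?G) ?a ?b =>
    let vars_a := collect_vars a (@nil (car G)) in
    let vars := collect_vars b vars_a in
    let a' := reify_expr a vars in
    let b' := reify_expr b vars in
    exact (eval_expr_eq G vars a' b' eq_refl)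
  end.

Lemma gsub_diag {G : LCAGroup} (x : G) : gsub x x = gzero.
Proof. abel. Qed.

Lemma gsub_zero_r {G : LCAGroup} (x : G) : gsub x gzero = x.
Proof. abel. Qed.

Lemma gadd_zero_r {G : LCAGroup} (x : G) : gadd x gzero = x.
Proof. abel. Qed.

Lemma gsub_add {G : LCAGroup} (x y : G) : gadd (gsub x y) y = x.
Proof. abel. Qed.

Lemma gsub_eq_zero {G : LCAGroup} (x y : G) : gsub x y = gzero -> x = y.
Proof. intros E. rewrite <- (gsub_add x y), E. apply gadd0. Qed.

(** * Compact sets *)

Record set_ideal {X : Type} (P : (X -> Prop) -> Prop) : Prop := {
  ideal_empty : P (fun _ => False);
  ideal_subset : forall A B, (forall x, A x -> B x) -> P B -> P A;
  ideal_union : forall A B, P A -> P B -> P (fun x => A x \/ B x)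
}.

Lemma ideal_list_union {X Y : Type} (P : (X -> Prop) -> Prop) (A : Y -> X -> Prop) l :
  set_ideal P -> (forall c, In c l -> P (A c)) -> P (fun x => exists c, In c l /\ A c x).
Proof.
intros ideal. induction l as [|c l IH]; intros PA.
- apply (ideal_subset _ ideal _ (fun _ => False)); [now intros x (? & [] & _)|].
  apply (ideal_empty _ ideal).
- apply (ideal_subset _ ideal _ (fun x => A c x \/ exists d, In d l /\ A d x)).
  + intros x (d & [<-|In_d] & Adx); [now left|right; now exists d].
  + apply (ideal_union _ ideal); [apply PA; now left|].
    apply IH. intros d In_d. apply PA. now right.
Qed.

Lemma compact_in_ideal {X : Type} (op : (X -> Prop) -> Prop) K P :
  set_ideal P -> is_compact op K ->
  (forall x, K x -> exists U, op U /\ U x /\ P U) -> P K.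
Proof.
intros ideal compK locally.
destruct (compK (fun U => op U /\ P U)) as (l & small & cover).
- now intros U [].
- intros x Kx. destruct (locally x Kx) as (U & ? & ? & ?). now exists U.
- apply (ideal_subset _ ideal _ _ cover), ideal_list_union; trivial.
  intros U In_U. now apply small.
Qed.

Lemma net_ideal {X Y : Type} (near : Y -> X -> Prop) :
  set_ideal (fun A => exists l, forall x, A x -> exists c, In c l /\ near c x).
Proof.
split.
- exists []. now intros x [].
- intros A B AB [l net]. exists l. auto.
- intros A B [l netA] [m netB]. exists (l ++ m).
  intros x [Ax|Bx]; [destruct (netA x Ax) as (c & ? & ?)|destruct (netB x Bx) as (c & ? & ?)];
    exists c; rewrite in_app_iff; auto.
Qed.

Definition finitely_covered {X : Type} (F : (X -> Prop) -> Prop) (A : X -> Prop) : Prop :=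
  exists l, (forall U, In U l -> F U) /\ forall x, A x -> exists U, In U l /\ U x.

Lemma finitely_covered_member {X : Type} (F : (X -> Prop) -> Prop) U :
  F U -> finitely_covered F U.
Proof.
intros FU. exists [U]. split.
- now intros V [<-|[]].
- intros x Ux. exists U. simpl. auto.
Qed.

Lemma finitely_covered_ideal {X : Type} (F : (X -> Prop) -> Prop) :
  set_ideal (finitely_covered F).
Proof.
split.
- exists []. split; [now intros ? []|easy].
- intros A B AB (l & Fl & cover). exists l. auto.
- intros A B (l & Fl & coverA) (m & Fm & coverB). exists (l ++ m). split.
  + intros U In_U. apply in_app_or in In_U. destruct In_U; auto.
  + intros x [Ax|Bx];
      [destruct (coverA x Ax) as (U & ? & ?)|destruct (coverB x Bx) as (U & ? & ?)];
      exists U; rewrite in_app_iff; auto.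
Qed.

Lemma is_compact_ext {X : Type} (op : (X -> Prop) -> Prop) A B :
  (forall x, A x <-> B x) -> is_compact op A -> is_compact op B.
Proof.
intros AB compA F openF cover.
apply (ideal_subset _ (finitely_covered_ideal F) _ A); [intros x; apply AB|].
apply compA; trivial. intros x Ax. now apply cover, AB.
Qed.

Lemma compact_list_union {X Y : Type} (op : (X -> Prop) -> Prop) (A : Y -> X -> Prop) l :
  (forall c, In c l -> is_compact op (A c)) ->
  is_compact op (fun x => exists c, In c l /\ A c x).
Proof.
intros compA F openF cover.
apply (ideal_list_union (finitely_covered F)); [apply finitely_covered_ideal|].
intros c In_c. apply compA; trivial. intros x Ax. apply cover. now exists c.
Qed.

Lemma compact_image {X Y : Type} (opX : (X -> Prop) -> Prop) (opY : (Y -> Prop) -> Prop)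
    (f : X -> Y) K :
  (forall V, opY V -> opX (fun x => V (f x))) ->
  is_compact opX K -> is_compact opY (fun y => exists x, K x /\ y = f x).
Proof.
intros contf compK F openF cover. destruct (finitely_covered_ideal F) as [empty subset union].
apply (compact_in_ideal opX K
         (fun A => finitely_covered F (fun y => exists x, A x /\ y = f x))); trivial.
- split.
  + apply (subset _ _) with (2 := empty). now intros y (x & [] & _).
  + intros A B AB. apply subset. intros y (x & Ax & E). exists x. auto.
  + intros A B cA cB. apply (subset _ _) with (2 := union _ _ cA cB).
    intros y (x & [Ax|Bx] & E); [left|right]; now exists x.
- intros x Kx. destruct (cover (f x)) as (V & FV & Vfx); [now exists x|].
  exists (fun x => V (f x)). repeat split; auto.
  apply (subset _ V); [now intros y (a & Va & ->)|now apply finitely_covered_member].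
Qed.

Lemma compact_prod (G H : LCAGroup) (K : G -> Prop) (B : H -> Prop) :
  is_compact (gopen G) K -> is_compact (gopen H) B ->
  is_compact (prod_open G H) (fun p => K (fst p) /\ B (snd p)).
Proof.
intros compK compB F openF cover.
destruct (finitely_covered_ideal F) as [empty subset union].
apply (compact_in_ideal (gopen G) K
         (fun A => finitely_covered F (fun p => A (fst p) /\ B (snd p)))); trivial.
{ split.
  - apply (subset _ _) with (2 := empty). tauto.
  - intros A A' AA'. apply subset. intros p []. auto.
  - intros A A' cA cA'. apply (subset _ _) with (2 := union _ _ cA cA'). tauto. }
(* The tube lemma: a finite cover of [{x} * B] covers [U * B] for some [U] around [x]. *)
intros x Kx.
apply (compact_in_ideal (gopen H) B (fun A => exists U, gopen G U /\ U x /\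
         finitely_covered F (fun p => U (fst p) /\ A (snd p)))); trivial.
{ split.
  - exists (fun _ => True). repeat split; [apply gopen_full|].
    apply (subset _ _) with (2 := empty). tauto.
  - intros A A' AA' (U & openU & Ux & cU). exists U. repeat split; trivial.
    apply (subset _ _) with (2 := cU). intros p []. auto.
  - intros A A' (U & openU & Ux & cU) (V & openV & Vx & cV).
    exists (fun a => U a /\ V a). repeat split; trivial; [now apply gopen_inter|].
    apply (subset _ _) with (2 := union _ _ cU cV). tauto. }
intros y By. destruct (cover (x, y)) as (O & FO & Oxy); [easy|].
destruct (openF O FO _ Oxy) as (U & V & openU & openV & Ux & Vy & UV).
exists V. repeat split; trivial. exists U. repeat split; trivial.
apply (subset _ O); [|now apply finitely_covered_member].
intros [a b] []. auto.
Qed.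

(** * Neighbourhoods of zero *)

Definition open_nbhd_zero {G : LCAGroup} (U : G -> Prop) : Prop := gopen G U /\ U gzero.

Definition symmetric_set {G : LCAGroup} (U : G -> Prop) : Prop :=
  forall x, U x -> U (gopp x).

Definition set_sub {G : LCAGroup} (A B : G -> Prop) (x : G) : Prop :=
  exists a b, A a /\ B b /\ x = gsub a b.

Lemma gopen_of_nbhds {G : LCAGroup} (A : G -> Prop) :
  (forall x, A x -> exists U, gopen G U /\ U x /\ forall y, U y -> A y) -> gopen G A.
Proof.
intros nbhds.
replace A with (fun x => exists U, (gopen G U /\ forall y, U y -> A y) /\ U x).
- apply gopen_union. now intros U [].
- extensionality x. apply propositional_extensionality. split.
  + intros (U & [_ UA] & Ux). auto.
  + intros Ax. destruct (nbhds x Ax) as (U & openU & Ux & UA). exists U. auto.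
Qed.

Lemma gopen_translate {G : LCAGroup} (U : G -> Prop) (c : G) :
  gopen G U -> gopen G (fun x => U (gadd x c)).
Proof.
intros openU. apply gopen_of_nbhds. intros x Ux.
destruct (gadd_cont G x c U openU Ux) as (V & W & openV & openW & Vx & Wc & VW).
exists V. auto.
Qed.

Lemma gopen_opp {G : LCAGroup} (U : G -> Prop) :
  gopen G U -> gopen G (fun x => U (gopp x)).
Proof.
intros openU. apply gopen_of_nbhds. intros x Ux. now apply gopp_cont.
Qed.

Lemma open_nbhd_zero_inter {G : LCAGroup} (U V : G -> Prop) :
  open_nbhd_zero U -> open_nbhd_zero V -> open_nbhd_zero (fun x => U x /\ V x).
Proof. intros [openU U0] [openV V0]. split; [now apply gopen_inter|easy]. Qed.

Lemma open_nbhd_zero_opp {G : LCAGroup} (U : G -> Prop) :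
  open_nbhd_zero U -> open_nbhd_zero (fun x => U (gopp x)).
Proof.
intros [openU U0]. split; [now apply gopen_opp|].
now replace (gopp gzero) with (@gzero G) by abel.
Qed.

Lemma open_nbhd_zero_translate {G : LCAGroup} (U : G -> Prop) c :
  open_nbhd_zero U -> gopen G (fun x => U (gsub x c)) /\ U (gsub c c).
Proof.
intros [openU U0]. split; [now apply gopen_translate|now rewrite gsub_diag].
Qed.

Lemma open_nbhd_zero_half {G : LCAGroup} (U : G -> Prop) :
  open_nbhd_zero U ->
  exists V, open_nbhd_zero V /\ symmetric_set V /\ forall x y, V x -> V y -> U (gadd x y).
Proof.
intros [openU U0]. rewrite <- (gadd0 G gzero) in U0.
destruct (gadd_cont G _ _ U openU U0) as (A & B & openA & openB & A0 & B0 & AB).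
assert (nbhdAB : open_nbhd_zero (fun x => A x /\ B x)) by now apply open_nbhd_zero_inter.
exists (fun x => (A x /\ B x) /\ (A (gopp x) /\ B (gopp x))). split; [|split].
- apply open_nbhd_zero_inter; trivial. now apply open_nbhd_zero_opp in nbhdAB.
- intros x Vx. replace (gopp (gopp x)) with x by abel. tauto.
- intros x y [[] _] [[] _]. auto.
Qed.

Lemma open_nbhd_zero_sub {G : LCAGroup} (U : G -> Prop) :
  open_nbhd_zero U ->
  exists V, open_nbhd_zero V /\ symmetric_set V /\ forall x y, V x -> V y -> U (gsub x y).
Proof.
intros nbhdU. destruct (open_nbhd_zero_half U nbhdU) as (V & nbhdV & symV & VV).
exists V. repeat split; try apply nbhdV; trivial. intros x y Vx Vy. apply VV; auto.
Qed.

Lemma open_nbhd_zero_third {G : LCAGroup} (U : G -> Prop) :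
  open_nbhd_zero U ->
  exists V, open_nbhd_zero V /\ symmetric_set V /\
    forall x y z, V x -> V y -> V z -> U (gadd x (gadd y z)).
Proof.
intros nbhdU. destruct (open_nbhd_zero_half U nbhdU) as (W & nbhdW & _ & WW).
destruct (open_nbhd_zero_half W nbhdW) as (V & nbhdV & symV & VV).
exists V. repeat split; try apply nbhdV; trivial. intros x y z Vx Vy Vz. apply WW; auto.
rewrite <- (gadd_zero_r x). apply VV; trivial. apply nbhdV.
Qed.

Lemma compact_nbhd_zero (G : LCAGroup) :
  exists U N, open_nbhd_zero U /\ (forall x : G, U x -> N x) /\ is_compact (gopen G) N.
Proof.
destruct (glocally_compact G gzero) as (U & N & openU & U0 & UN & compN).
now exists U, N.
Qed.

Lemma compact_translate {G : LCAGroup} (A : G -> Prop) (c : G) :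
  is_compact (gopen G) A -> is_compact (gopen G) (fun x => A (gsub x c)).
Proof.
intros compA.
apply (is_compact_ext _ (fun y => exists x, A x /\ y = gadd x c)).
- intros y. split.
  + intros (x & Ax & ->). now replace (gsub (gadd x c) c) with x by abel.
  + intros Ay. exists (gsub y c). split; trivial. abel.
- apply compact_image with (opX := gopen G); trivial. intros V. apply gopen_translate.
Qed.

(** * Totally bounded and relatively dense sets *)

Definition totally_bounded {G : LCAGroup} (A : G -> Prop) : Prop :=
  forall U, open_nbhd_zero U ->
    exists l : list G, forall x, A x -> exists c, In c l /\ U (gsub x c).

Lemma compact_totally_bounded {G : LCAGroup} (A : G -> Prop) :
  is_compact (gopen G) A -> totally_bounded A.
Proof.
intros compA U nbhdU. apply (compact_in_ideal (gopen G) A) with (2 := compA).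
- apply (net_ideal (fun c x => U (gsub x c))).
- intros c _. destruct (open_nbhd_zero_translate U c nbhdU) as [open_c Ucc].
  exists (fun x => U (gsub x c)). repeat split; trivial.
  exists [c]. intros x Ux. exists c. simpl. auto.
Qed.

Lemma totally_bounded_sub {G : LCAGroup} (A B : G -> Prop) :
  totally_bounded A -> totally_bounded B -> totally_bounded (set_sub A B).
Proof.
intros tbA tbB U nbhdU. destruct (open_nbhd_zero_sub U nbhdU) as (V & nbhdV & _ & VV).
destruct (tbA V nbhdV) as [l netA]. destruct (tbB V nbhdV) as [m netB].
exists (flat_map (fun c => map (gsub c) m) l).
intros x (a & b & Aa & Bb & ->).
destruct (netA a Aa) as (c & In_c & Vac). destruct (netB b Bb) as (d & In_d & Vbd).
exists (gsub c d). split.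
- apply in_flat_map. exists c. split; trivial. now apply in_map.
- replace (gsub (gsub a b) (gsub c d)) with (gsub (gsub a c) (gsub b d)) by abel. auto.
Qed.

Lemma totally_bounded_subset {G : LCAGroup} (A B : G -> Prop) :
  (forall x, A x -> B x) -> totally_bounded B -> totally_bounded A.
Proof.
intros AB tbB U nbhdU. destruct (tbB U nbhdU) as [l net]. exists l. auto.
Qed.

Lemma totally_bounded_of_compact_closure {G : LCAGroup} (A : G -> Prop) :
  is_compact (gopen G) (closure (gopen G) A) -> totally_bounded A.
Proof.
intros comp. apply (totally_bounded_subset A (closure (gopen G) A)).
- intros x Ax U _ Ux. now exists x.
- now apply compact_totally_bounded.
Qed.

Lemma totally_bounded_opp {G : LCAGroup} (A : G -> Prop) :
  totally_bounded A -> totally_bounded (fun x => A (gopp x)).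
Proof.
intros tbA U nbhdU. destruct (tbA _ (open_nbhd_zero_opp U nbhdU)) as [l net].
exists (map gopp l). intros x Ax. destruct (net _ Ax) as (c & In_c & Uc).
exists (gopp c). split; [now apply in_map|].
now replace (gsub x (gopp c)) with (gopp (gsub (gopp x) c)) by abel.
Qed.

Lemma totally_bounded_list {G : LCAGroup} (l : list G) :
  totally_bounded (fun x => In x l).
Proof.
intros U [_ U0]. exists l. intros x In_x. exists x. now rewrite gsub_diag.
Qed.

Lemma totally_bounded_in_compact {G : LCAGroup} (A : G -> Prop) :
  totally_bounded A -> exists K, is_compact (gopen G) K /\ forall x, A x -> K x.
Proof.
intros tbA. destruct (compact_nbhd_zero G) as (U & N & nbhdU & UN & compN).
destruct (tbA U nbhdU) as [l net].
exists (fun x => exists c, In c l /\ N (gsub x c)). split.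
- apply (compact_list_union (gopen G) (fun c x => N (gsub x c))).
  intros c _. now apply compact_translate.
- intros x Ax. destruct (net x Ax) as (c & In_c & Uxc). exists c. auto.
Qed.

Lemma relatively_dense_of_totally_bounded {G : LCAGroup} (A B : G -> Prop) :
  totally_bounded B -> (forall g, exists a, A a /\ B (gsub g a)) -> relatively_dense G A.
Proof.
intros tbB near. destruct (totally_bounded_in_compact B tbB) as (K & compK & BK).
exists K. split; trivial. intros g. destruct (near g) as (a & Aa & Ba).
exists a, (gsub g a). repeat split; auto. abel.
Qed.

Lemma relatively_dense_near {G : LCAGroup} (A A' B : G -> Prop) :
  relatively_dense G A -> totally_bounded B ->
  (forall a, A a -> exists a', A' a' /\ B (gsub a a')) -> relatively_dense G A'.
Proof.
intros (K & compK & dense) tbB near.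
apply (relatively_dense_of_totally_bounded _ (set_sub B (fun x => K (gopp x)))).
- apply totally_bounded_sub; trivial. now apply totally_bounded_opp, compact_totally_bounded.
- intros g. destruct (dense g) as (a & k & Aa & Kk & ->).
  destruct (near a Aa) as (a' & A'a' & Baa'). exists a'. split; trivial.
  exists (gsub a a'), (gopp k). repeat split; trivial; [|abel].
  now replace (gopp (gopp k)) with k by abel.
Qed.

Lemma relatively_dense_superset {G : LCAGroup} (A A' : G -> Prop) :
  (forall x, A x -> A' x) -> relatively_dense G A -> relatively_dense G A'.
Proof.
intros AA' denseA.
apply (relatively_dense_near A A' (fun x => In x [gzero])); trivial.
- apply totally_bounded_list.
- intros a Aa. exists a. split; auto. left. now rewrite gsub_diag.
Qed.

(** * Locally finite and uniformly discrete sets *)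

Lemma finite_of_injective_cover {X Y : Type} (A : X -> Prop) (box : Y -> X -> Prop) l :
  (forall x, A x -> exists c, In c l /\ box c x) ->
  (forall c x y, A x -> A y -> box c x -> box c y -> x = y) ->
  exists m, (length m <= length l)%nat /\ forall x, A x -> In x m.
Proof.
revert A. induction l as [|c l IH]; intros A cover inj.
- exists []. split; trivial. intros x Ax. now destruct (cover x Ax) as (? & [] & _).
- destruct (IH (fun x => A x /\ ~ box c x)) as (m & short & listed).
  + intros x [Ax outside]. destruct (cover x Ax) as (d & [<-|In_d] & box_d); [easy|].
    now exists d.
  + intros d x y [] []. eauto.
  + destruct (classic (exists x, A x /\ box c x)) as [(x & Ax & box_x)|no_x].
    * exists (x :: m). split; [simpl; lia|]. intros y Ay.
      destruct (classic (box c y)); [left; eauto|right; auto].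
    * exists m. split; [simpl; lia|]. intros y Ay. apply listed. split; trivial. eauto.
Qed.

Lemma open_nbhd_zero_avoiding {G : LCAGroup} (l : list G) :
  exists U, open_nbhd_zero U /\ forall x, In x l -> U x -> x = gzero.
Proof.
induction l as [|c l (U & nbhdU & avoidU)].
- exists (fun _ => True). split; [split; [apply gopen_full|easy]|now intros ? []].
- destruct (classic (c = gzero)) as [->|c_neq0].
  + exists U. split; trivial. intros x [<-|In_x]; auto.
  + destruct (ghausdorff G c gzero c_neq0) as (A & B & openA & openB & Ac & B0 & disjoint).
    exists (fun x => U x /\ B x). split; [now apply open_nbhd_zero_inter|].
    intros x [<-|In_x] [Ux Bx]; [now destruct (disjoint c)|auto].
Qed.

Lemma locally_finite_isolated_zero {G : LCAGroup} (A : G -> Prop) :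
  locally_finite G A ->
  exists U, open_nbhd_zero U /\ forall x, A x -> U x -> x = gzero.
Proof.
intros finA. destruct (compact_nbhd_zero G) as (U & N & nbhdU & UN & compN).
destruct (finA N compN) as [l listed].
destruct (open_nbhd_zero_avoiding l) as (V & nbhdV & avoidV).
exists (fun x => U x /\ V x). split; [now apply open_nbhd_zero_inter|].
intros x Ax [Ux Vx]. auto.
Qed.

Lemma locally_finite_subset {G : LCAGroup} (A B : G -> Prop) :
  (forall x, A x -> B x) -> locally_finite G B -> locally_finite G A.
Proof.
intros AB finB K compK. destruct (finB K compK) as [l listed]. exists l. auto.
Qed.

Lemma diffset_subset {G : LCAGroup} (A B : G -> Prop) :
  (forall x, A x -> B x) -> forall x, diffset G A x -> diffset G B x.
Proof. intros AB x (a & b & Aa & Ab & ->). exists a, b. auto. Qed.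

Lemma flc_uniformly_discrete {G : LCAGroup} (L : G -> Prop) :
  finite_local_complexity G L -> uniformly_discrete G L.
Proof.
intros flc. destruct (locally_finite_isolated_zero _ flc) as (U & [openU U0] & isolated).
exists U. repeat split; trivial. intros x y Lx Ly Uxy. apply gsub_eq_zero, isolated; trivial.
now exists x, y.
Qed.

Definition meets_translates_at_most {G : LCAGroup} (L A : G -> Prop) (N : nat) : Prop :=
  forall s, exists l, (length l <= N)%nat /\ forall x, L x -> A (gsub x s) -> In x l.

Lemma uniformly_discrete_meets {G : LCAGroup} (L A : G -> Prop) :
  uniformly_discrete G L -> totally_bounded A -> exists N, meets_translates_at_most L A N.
Proof.
intros (U & openU & U0 & discrete) tbA.
destruct (open_nbhd_zero_sub U) as (V & nbhdV & _ & VV); [easy|].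
destruct (tbA V nbhdV) as [centers net]. exists (length centers). intros s.
destruct (finite_of_injective_cover (fun x => L x /\ A (gsub x s))
            (fun c x => V (gsub (gsub x s) c)) centers) as (l & short & listed).
- intros x [_ Ax]. auto.
- intros c x y [Lx _] [Ly _] Vx Vy. apply discrete; trivial.
  replace (gsub x y) with (gsub (gsub (gsub x s) c) (gsub (gsub y s) c)) by abel. auto.
- exists l. auto.
Qed.

Lemma uniformly_discrete_locally_finite {G : LCAGroup} (A : G -> Prop) :
  uniformly_discrete G A -> locally_finite G A.
Proof.
intros udA K compK.
destruct (uniformly_discrete_meets A K udA (compact_totally_bounded K compK)) as [N meets].
destruct (meets gzero) as (l & _ & listed). exists l. intros x Ax Kx. apply listed; trivial.
now rewrite gsub_zero_r.
Qed.

Lemma meets_translates_of_shifted_difference {G : LCAGroup} (L A : G -> Prop) (w : G -> R) N t :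
  meets_translates_at_most L A N -> (forall x, ~ L x -> w x = 0) ->
  meets_translates_at_most (fun x => w (gadd x t) - w x <> 0) A (N + N).
Proof.
intros meets support s.
destruct (meets s) as (l & short_l & listed_l).
destruct (meets (gadd s t)) as (m & short_m & listed_m).
exists (l ++ map (fun y => gsub y t) m). split; [rewrite length_app, length_map; lia|].
intros x diff As. apply in_or_app.
destruct (classic (L x)) as [Lx|notLx]; [left; auto|right].
apply in_map_iff. exists (gadd x t). split; [abel|]. apply listed_m.
- apply NNPP. intros notLxt. apply diff. rewrite (support _ notLx), (support _ notLxt). ring.
- now replace (gsub (gadd x t) (gadd s t)) with (gsub x s) by abel.
Qed.

(** * Finite sums *)

Lemma lsum_app {X : Type} (a : X -> R) l m : lsum a (l ++ m) = lsum a l + lsum a m.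
Proof. induction l as [|x l IH]; simpl; [ring|rewrite IH; ring]. Qed.

Lemma lsum_ge0 {X : Type} (a : X -> R) l : (forall x, 0 <= a x) -> 0 <= lsum a l.
Proof.
intros a_ge0. induction l as [|x l IH]; simpl; [lra|]. generalize (a_ge0 x). lra.
Qed.

Lemma lsum_map {X Y : Type} (a : Y -> R) (g : X -> Y) l :
  lsum a (map g l) = lsum (fun x => a (g x)) l.
Proof. induction l; simpl; congruence. Qed.

Lemma lsum_minus {X : Type} (a b : X -> R) l :
  lsum (fun x => a x - b x) l = lsum a l - lsum b l.
Proof. induction l as [|x l IH]; simpl; [ring|rewrite IH; ring]. Qed.

Lemma Rabs_lsum {X : Type} (a : X -> R) l : Rabs (lsum a l) <= lsum (fun x => Rabs (a x)) l.
Proof.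
induction l as [|x l IH]; simpl; [rewrite Rabs_R0; lra|].
eapply Rle_trans; [apply Rabs_triang|lra].
Qed.

Lemma lsum_perm {X : Type} (a : X -> R) l m : Permutation l m -> lsum a l = lsum a m.
Proof. induction 1; simpl; lra. Qed.

Lemma lsum_filter {X : Type} (a : X -> R) p l :
  (forall x, In x l -> p x = false -> a x = 0) -> lsum a (filter p l) = lsum a l.
Proof.
induction l as [|x l IH]; intros zero; trivial. simpl.
rewrite <- IH by (intros y In_y; apply zero; now right).
destruct (p x) eqn:px; trivial. rewrite (zero x); trivial; [ring|now left].
Qed.

Lemma lsum_le_length {X : Type} (a : X -> R) e l :
  (forall x, a x <= e) -> lsum a l <= INR (length l) * e.
Proof.
intros a_le. induction l as [|x l IH]; [simpl; lra|].
change (length (x :: l)) with (S (length l)). rewrite S_INR. simpl.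
generalize (a_le x). lra.
Qed.

Lemma lsum_split {X : Type} (a : X -> R) c l :
  (forall x, 0 <= a x) -> l <> [] -> 0 <= c <= lsum a l ->
  exists l1 x l2, l = l1 ++ x :: l2 /\ lsum a l1 <= c /\ lsum a l2 <= lsum a l - c.
Proof.
intros a_ge0. revert c. induction l as [|x l IH]; intros c nonempty [c_ge0 c_le]; [easy|].
simpl in c_le. destruct (Rle_lt_dec c (a x)) as [c_le_ax|ax_lt_c].
- exists [], x, l. simpl. repeat split; lra.
- destruct (IH (c - a x)) as (l1 & y & l2 & -> & before & after).
  + intros ->. simpl in c_le. lra.
  + lra.
  + exists (x :: l1), y, l2. simpl. repeat split; lra.
Qed.

(** * Uniformly continuous bump functions *)

Lemma Rabs_le_inv a b : Rabs a <= b -> - b <= a <= b.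
Proof. unfold Rabs. destruct (Rcase_abs a); lra. Qed.

Lemma pow_half_pos k : 0 < (/ 2) ^ k.
Proof. apply pow_lt. lra. Qed.

Lemma pow_half_antitone m n : (m <= n)%nat -> (/ 2) ^ n <= (/ 2) ^ m.
Proof.
induction 1 as [|n _ IH]; [lra|]. simpl. generalize (pow_half_pos n). lra.
Qed.

Lemma pow_half_small eps : 0 < eps -> exists k, (/ 2) ^ k < eps.
Proof.
intros eps_pos. destruct (pow_lt_1_zero (/ 2)) with (y := eps) as [N small]; trivial.
- rewrite Rabs_pos_eq; lra.
- exists N. specialize (small N (le_n N)). rewrite Rabs_pos_eq in small; trivial.
  apply Rlt_le, pow_half_pos.
Qed.

Lemma dependent_choice {X : Type} (step : X -> X -> Prop) (x0 : X) :
  (forall x, exists y, step x y) ->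
  exists f, f O = x0 /\ forall n, step (f n) (f (S n)).
Proof.
intros next. now apply (functional_choice_imp_functional_dependent_choice (@choice)).
Qed.

Section Chains.
Variables (G : LCAGroup) (V : nat -> G -> Prop).
Hypothesis V_nbhd : forall n, open_nbhd_zero (V n).
Hypothesis V_third :
  forall n x y z, V (S n) x -> V (S n) y -> V (S n) z -> V n (gadd x (gadd y z)).

Definition is_chain (l : list (nat * G)) : Prop :=
  forall s, In s l -> V (fst s) (snd s).

Definition chain_length (l : list (nat * G)) : R := lsum (fun s => (/ 2) ^ fst s) l.

Definition chain_end (l : list (nat * G)) : G :=
  fold_right (fun s x => gadd (snd s) x) gzero l.

Lemma nbhds_antitone m n x : (m <= n)%nat -> V n x -> V m x.
Proof.
induction 1 as [|n _ IH]; trivial. intros Vx. apply IH.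
rewrite <- (gadd_zero_r x), <- (gadd_zero_r gzero). apply V_third; trivial; apply V_nbhd.
Qed.

Lemma chain_end_app l m : chain_end (l ++ m) = gadd (chain_end l) (chain_end m).
Proof.
induction l as [|s l IH]; simpl; [now rewrite gadd0|]. now rewrite IH, gaddA.
Qed.

(* Birkhoff and Kakutani: cut the chain in its middle step; each half is shorter
   than [2 ^ - S k], hence by induction ends in [V (S k)]. *)
Lemma chain_end_in_nbhd l k :
  is_chain l -> chain_length l < (/ 2) ^ k -> V k (chain_end l).
Proof.
revert k. induction l as [l IH] using (induction_ltof1 _ (@length _)).
intros k chain_l short.
assert (step_ge0 : forall s : nat * G, 0 <= (/ 2) ^ fst s).
{ intros s. apply Rlt_le, pow_half_pos. }
destruct (classic (l = [])) as [->|nonempty]; [apply V_nbhd|].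
assert (length_ge0 : 0 <= chain_length l) by now apply lsum_ge0.
destruct (lsum_split (fun s => (/ 2) ^ fst s) (chain_length l / 2) l)
  as (l1 & [n v] & l2 & -> & half1 & half2); trivial.
{ unfold chain_length in *. lra. }
unfold chain_length in *. rewrite lsum_app in *. simpl in *.
generalize (lsum_ge0 _ l1 step_ge0) (lsum_ge0 _ l2 step_ge0). intros l1_ge0 l2_ge0.
rewrite chain_end_app. apply V_third.
- apply IH; [unfold ltof; rewrite length_app; simpl; lia| |simpl; lra].
  intros s In_s. apply chain_l, in_or_app. now left.
- apply (nbhds_antitone (S k) n); [|apply (chain_l (n, v)), in_elt].
  apply Nat.nlt_ge. intros n_le_k.
  assert ((/ 2) ^ k <= (/ 2) ^ n) by (apply pow_half_antitone; lia). lra.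
- apply IH; [unfold ltof; rewrite length_app; simpl; lia| |simpl; lra].
  intros s In_s. apply chain_l, in_or_app. simpl. auto.
Qed.

Definition chain_height (x : G) (r : R) : Prop :=
  r = 0 \/ exists l, is_chain l /\ chain_end l = x /\ r = 1 - chain_length l.

Lemma chain_height_le1 x r : chain_height x r -> r <= 1.
Proof.
intros [->|(l & _ & _ & ->)]; [lra|].
assert (0 <= chain_length l) by (apply lsum_ge0; intros s; apply Rlt_le, pow_half_pos). lra.
Qed.

Lemma chain_height_lub_exists : exists f : G -> R, forall x, is_lub (chain_height x) (f x).
Proof.
apply (choice (fun x => is_lub (chain_height x))). intros x.
destruct (completeness (chain_height x)) as [m lub].
- exists 1. intros r. apply chain_height_le1.
- exists 0. now left.
- now exists m.
Qed.

Lemma chain_height_lub_decrease (f : G -> R) n x v :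
  (forall x, is_lub (chain_height x) (f x)) -> V n v -> f x - (/ 2) ^ n <= f (gadd x v).
Proof.
intros lub Vv.
assert (f x <= f (gadd x v) + (/ 2) ^ n); [|lra].
apply lub. intros r [->|(l & chain_l & end_l & ->)].
- generalize (proj1 (lub (gadd x v)) 0 (or_introl eq_refl)) (pow_half_pos n). lra.
- assert (longer : 1 - ((/ 2) ^ n + chain_length l) <= f (gadd x v)); [|lra].
  apply lub. right. exists ((n, v) :: l). repeat split.
  + intros s [<-|In_s]; auto.
  + simpl. rewrite end_l. apply gaddC.
Qed.
End Chains.

Definition uniformly_continuous {G : LCAGroup} (f : G -> R) : Prop :=
  forall eps, 0 < eps -> exists V, open_nbhd_zero V /\
    forall v x, V v -> Rabs (f (gadd x v) - f x) <= eps.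

Lemma uniformly_continuous_continuous {G : LCAGroup} (f : G -> R) :
  uniformly_continuous f -> continuous_fun G f.
Proof.
intros unif x eps eps_pos. destruct (unif (eps / 2)) as (V & nbhdV & close); [lra|].
destruct (open_nbhd_zero_translate V x nbhdV) as [open_x Vxx].
exists (fun y => V (gsub y x)). repeat split; trivial.
intros y Vyx. specialize (close _ x Vyx).
replace (gadd x (gsub y x)) with y in close by abel. lra.
Qed.

Lemma nbhd_third_sequence {G : LCAGroup} (U : G -> Prop) :
  open_nbhd_zero U ->
  exists V : nat -> G -> Prop, (forall x, V O x -> U x) /\
    (forall n, open_nbhd_zero (V n)) /\ (forall n, symmetric_set (V n)) /\
    forall n x y z, V (S n) x -> V (S n) y -> V (S n) z -> V n (gadd x (gadd y z)).
Proof.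
intros nbhdU.
destruct (dependent_choice (fun V W : G -> Prop => open_nbhd_zero V ->
    open_nbhd_zero W /\ symmetric_set W /\
    forall x y z, W x -> W y -> W z -> V (gadd x (gadd y z))) U) as (V & V_O & V_step).
{ intros V. destruct (classic (open_nbhd_zero V)) as [nbhdV|not_nbhd].
  - destruct (open_nbhd_zero_third V nbhdV) as (W & HW). now exists W.
  - now exists V. }
assert (nbhds : forall n, open_nbhd_zero (V n)).
{ induction n as [|n IH]; [now rewrite V_O|now apply V_step]. }
exists (fun n => V (S n)). split; [|split; [|split]]; trivial; try (intros; now apply V_step).
intros x Vx. rewrite <- V_O, <- (gadd_zero_r x), <- (gadd_zero_r gzero).
apply V_step; trivial; apply nbhds.
Qed.

Lemma uniformly_continuous_bump {G : LCAGroup} (U : G -> Prop) :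
  open_nbhd_zero U ->
  exists f : G -> R, (forall x, 0 <= f x <= 1) /\ f gzero = 1 /\
    (forall x, f x <> 0 -> U x) /\ uniformly_continuous f.
Proof.
intros nbhdU.
destruct (nbhd_third_sequence U nbhdU) as (V & VU & V_nbhd & V_symmetric & V_third).
destruct (chain_height_lub_exists G V) as [f lub].
assert (f01 : forall x, 0 <= f x <= 1).
{ intros x. split.
  - apply lub. now left.
  - apply lub. intros r. apply chain_height_le1. }
exists f. repeat split; try apply f01.
- apply Rle_antisym; [apply f01|]. apply lub. right. exists []. repeat split.
  + now intros s [].
  + unfold chain_length. simpl. lra.
- intros x fx_neq0. apply VU, NNPP. intros notVx.
  assert (f x <= 0); [|specialize (f01 x); lra].
  apply lub. intros r [->|(l & chain_l & <- & ->)]; [lra|].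
  apply Rnot_lt_le. intros short. apply notVx, chain_end_in_nbhd; trivial. simpl. lra.
- intros eps eps_pos. destruct (pow_half_small eps eps_pos) as [n small].
  exists (V n). split; trivial. intros v x Vv. apply Rabs_le.
  assert (lower := chain_height_lub_decrease G V f n x v lub Vv).
  assert (upper := chain_height_lub_decrease G V f n (gadd x v) (gopp v) lub
                     (V_symmetric n v Vv)).
  replace (gadd (gadd x v) (gopp v)) with x in upper by abel. lra.
Qed.

(** * Unordered sums *)

Definition classic_dec {X : Type} (x y : X) : {x = y} + {x <> y} :=
  excluded_middle_informative (x = y).

Lemma lsum_subset {X : Type} (a : X -> R) l m :
  NoDup l -> NoDup m -> incl l m -> (forall x, In x m -> ~ In x l -> a x = 0) ->
  lsum a m = lsum a l.
Proof.
intros nodup_l nodup_m sub zero.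
set (in_l := fun x => if in_dec classic_dec x l then true else false).
assert (in_lP : forall x, in_l x = true <-> In x l).
{ intros x. unfold in_l. now destruct (in_dec classic_dec x l). }
rewrite <- (lsum_filter a in_l).
- apply lsum_perm, NoDup_Permutation; trivial; [now apply NoDup_filter|].
  intros x. rewrite filter_In, in_lP. split; [tauto|]. auto.
- intros x In_x out. apply zero; trivial. rewrite <- in_lP, out. easy.
Qed.

Lemma lsum_le_support {X : Type} (a : X -> R) e l m :
  0 <= e -> NoDup l -> (forall x, a x <= e) -> (forall x, In x l -> a x <> 0 -> In x m) ->
  lsum a l <= INR (length m) * e.
Proof.
intros e_ge0 nodup_l a_le support.
set (nonzero := fun x => if Req_dec_T (a x) 0 then false else true).
assert (nonzeroP : forall x, nonzero x = true <-> a x <> 0).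
{ intros x. unfold nonzero. now destruct (Req_dec_T (a x) 0). }
rewrite <- (lsum_filter a nonzero).
- eapply Rle_trans; [now apply lsum_le_length|].
  apply Rmult_le_compat_r; trivial. apply le_INR, NoDup_incl_length.
  + now apply NoDup_filter.
  + intros x. rewrite filter_In, nonzeroP. intros []. auto.
- intros x _ zero. apply NNPP. rewrite <- nonzeroP, zero. easy.
Qed.

Lemma HasSum_unique {X : Type} (a : X -> R) s s' : HasSum a s -> HasSum a s' -> s = s'.
Proof.
intros sum_s sum_s'. apply NNPP. intros ne.
assert (gap : 0 < Rabs (s - s') / 2).
{ assert (0 < Rabs (s - s')) by (apply Rabs_pos_lt; lra). lra. }
destruct (sum_s _ gap) as [l near_s]. destruct (sum_s' _ gap) as [m near_s'].
specialize (near_s (nodup classic_dec (l ++ m)) (NoDup_nodup _ _)).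
specialize (near_s' (nodup classic_dec (l ++ m)) (NoDup_nodup _ _)).
assert (near : Rabs (lsum a (nodup classic_dec (l ++ m)) - s) < Rabs (s - s') / 2).
{ apply near_s. intros x In_x. apply nodup_In, in_or_app. auto. }
assert (near' : Rabs (lsum a (nodup classic_dec (l ++ m)) - s') < Rabs (s - s') / 2).
{ apply near_s'. intros x In_x. apply nodup_In, in_or_app. auto. }
revert near near'. unfold Rabs. repeat destruct (Rcase_abs _); lra.
Qed.

Lemma HasSum_finite {X : Type} (a : X -> R) l :
  (forall x, a x <> 0 -> In x l) -> HasSum a (lsum a (nodup classic_dec l)).
Proof.
intros support eps eps_pos. exists (nodup classic_dec l). intros m nodup_m sub.
rewrite (lsum_subset a (nodup classic_dec l) m), Rminus_diag, Rabs_R0; trivial.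
- apply NoDup_nodup.
- intros x _. rewrite nodup_In. intros notIn. apply NNPP. auto.
Qed.

Lemma HasSum_minus {X : Type} (a b : X -> R) s s' :
  HasSum a s -> HasSum b s' -> HasSum (fun x => a x - b x) (s - s').
Proof.
intros sum_a sum_b eps eps_pos.
destruct (sum_a (eps / 2)) as [l near_a]; [lra|].
destruct (sum_b (eps / 2)) as [m near_b]; [lra|].
exists (l ++ m). intros k nodup_k sub. rewrite lsum_minus.
specialize (near_a k nodup_k). specialize (near_b k nodup_k).
assert (lsum_a : Rabs (lsum a k - s) < eps / 2).
{ apply near_a. intros x In_x. apply sub, in_or_app. auto. }
assert (lsum_b : Rabs (lsum b k - s') < eps / 2).
{ apply near_b. intros x In_x. apply sub, in_or_app. auto. }
revert lsum_a lsum_b. unfold Rabs. repeat destruct (Rcase_abs _); lra.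
Qed.

Lemma HasSum_translate {G : LCAGroup} (a : G -> R) s (t : G) :
  HasSum a s -> HasSum (fun y => a (gadd y t)) s.
Proof.
intros sum_a eps eps_pos. destruct (sum_a eps eps_pos) as [l near].
exists (map (fun y => gsub y t) l). intros m nodup_m sub.
rewrite <- (lsum_map a (fun y => gadd y t)). apply near.
- apply FinFun.Injective_map_NoDup; trivial. intros x y E.
  replace x with (gsub (gadd x t) t) by abel. rewrite E. abel.
- intros y In_y. apply in_map_iff. exists (gsub y t). split; [abel|].
  apply sub. now apply (in_map (fun y => gsub y t)).
Qed.

Lemma HasSum_le_support {X : Type} (a : X -> R) s e m :
  0 <= e -> HasSum a s -> (forall x, Rabs (a x) <= e) -> (forall x, a x <> 0 -> In x m) ->
  Rabs s <= INR (length m) * e.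
Proof.
intros e_ge0 sum_a a_le support.
rewrite (HasSum_unique a s (lsum a (nodup classic_dec m))); trivial.
- eapply Rle_trans; [apply Rabs_lsum|]. apply lsum_le_support; trivial; [apply NoDup_nodup|].
  intros x In_x _. now apply nodup_In in In_x.
- now apply HasSum_finite.
Qed.

(** * Sup- and norm-almost periodicity *)

Lemma exists_small_factor C eps : 0 <= C -> 0 < eps -> exists d, 0 < d /\ C * d < eps.
Proof.
intros C_ge0 eps_pos. exists (eps / (C + 1)).
assert (E : (C + 1) * (eps / (C + 1)) = eps) by (field; lra).
assert (0 < eps / (C + 1)) by (apply Rdiv_lt_0_compat; lra). lra.
Qed.

Lemma Rabs_bound_ge0 {G : LCAGroup} (g : G -> R) e : (forall x, Rabs (g x) <= e) -> 0 <= e.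
Proof. intros bound. eapply Rle_trans; [apply Rabs_pos|apply (bound gzero)]. Qed.

Lemma nonzero_weight_in {G : LCAGroup} (L : G -> Prop) (w : G -> R) x :
  (forall x, ~ L x -> w x = 0) -> w x <> 0 -> L x.
Proof. intros support w_neq0. apply NNPP. auto. Qed.

Lemma norm_ap_of_sup_ap {G : LCAGroup} (L K : G -> Prop) (w : G -> R) :
  totally_bounded K -> uniformly_discrete G L -> (forall x, ~ L x -> w x = 0) ->
  sup_ap G w -> norm_ap G K w.
Proof.
intros tbK udL support sap eps eps_pos.
destruct (uniformly_discrete_meets L K udL tbK) as [N meets].
destruct (exists_small_factor (INR (N + N)) eps) as (d & d_pos & small); trivial.
{ apply pos_INR. }
apply (relatively_dense_superset _ _) with (2 := sap d d_pos).
intros t (e & e_lt & close). assert (e_ge0 := Rabs_bound_ge0 _ _ close).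
exists (INR (N + N) * e). split.
{ generalize (pos_INR (N + N)). nra. }
intros s l nodup_l l_in_K.
destruct (meets_translates_of_shifted_difference L K w N (gopp t) meets support s)
  as (m & short & listed).
apply Rle_trans with (INR (length m) * e).
- apply lsum_le_support; trivial.
  + intros x. replace x with (gadd t (gsub x t)) at 1 by abel. apply close.
  + intros x In_x diff. apply listed; [|auto]. intros E. apply diff.
    change (gsub x t) with (gadd x (gopp t)). rewrite Rabs_minus_sym, E. apply Rabs_R0.
- apply le_INR in short. now apply Rmult_le_compat_r.
Qed.

Lemma sup_ap_of_norm_ap {G : LCAGroup} (K : G -> Prop) (w : G -> R) k :
  K k -> norm_ap G K w -> sup_ap G w.
Proof.
intros Kk nap eps eps_pos. apply (relatively_dense_superset _ _) with (2 := nap eps eps_pos).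
intros t (e & e_lt & close). exists e. split; trivial. intros x.
specialize (close (gsub (gadd t x) k) [gadd t x]).
simpl in close. replace (gsub (gadd t x) t) with x in close by abel.
rewrite Rplus_0_r in close. apply close.
- constructor; [now intros []|constructor].
- intros y [<-|[]]. now replace (gsub (gadd t x) (gsub (gadd t x) k)) with k by abel.
Qed.

(** * Strong almost periodicity *)

Lemma compact_support_bounded {G : LCAGroup} (f : G -> R) :
  continuous_fun G f -> compact_support G f -> exists M, 0 <= M /\ forall x, Rabs (f x) <= M.
Proof.
intros cont (K & compK & support).
destruct (compact_in_ideal (gopen G) K
            (fun A => exists M, forall x, A x -> Rabs (f x) <= M)) as [M bound]; trivial.
- split.
  + now exists 0.
  + intros A B AB [M bound]. exists M. auto.
  + intros A B [M boundA] [M' boundB]. exists (Rmax M M'). intros x [Ax|Bx].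
    * eapply Rle_trans; [now apply boundA|apply Rmax_l].
    * eapply Rle_trans; [now apply boundB|apply Rmax_r].
- intros x _. destruct (cont x 1) as (U & openU & Ux & close); [lra|].
  exists U. repeat split; trivial. exists (Rabs (f x) + 1). intros y Uy.
  specialize (close y Uy). generalize (Rabs_triang_inv (f y) (f x)). lra.
- exists (Rmax 0 M). split; [apply Rmax_l|]. intros x. destruct (classic (K x)) as [Kx|notKx].
  + eapply Rle_trans; [now apply bound|apply Rmax_r].
  + rewrite (support x notKx), Rabs_R0. apply Rmax_l.
Qed.

Definition continuous_at {G : LCAGroup} (f : G -> R) (x : G) : Prop :=
  forall eps, 0 < eps -> exists U, gopen G U /\ U x /\ forall y, U y -> Rabs (f y - f x) < eps.

Lemma continuous_at_lsum {G : LCAGroup} {X : Type} (g : X -> G -> R) (c : X -> R) l x :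
  (forall i, continuous_at (g i) x) ->
  continuous_at (fun y => lsum (fun i => g i y * c i) l) x.
Proof.
intros cont. induction l as [|i l IH]; intros eps eps_pos; simpl.
- exists (fun _ => True). repeat split; [apply gopen_full|].
  intros y _. rewrite Rminus_diag, Rabs_R0. lra.
- destruct (exists_small_factor (Rabs (c i)) (eps / 2)) as (d & d_pos & small);
    [apply Rabs_pos|lra|].
  destruct (cont i d d_pos) as (U & openU & Ux & closeU).
  destruct (IH (eps / 2)) as (V & openV & Vx & closeV); [lra|].
  exists (fun y => U y /\ V y). repeat split; trivial; [now apply gopen_inter|].
  intros y [Uy Vy]. specialize (closeU y Uy). specialize (closeV y Vy).
  replace (g i y * c i + lsum (fun j => g j y * c j) l
           - (g i x * c i + lsum (fun j => g j x * c j) l))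
    with ((g i y - g i x) * c i
          + (lsum (fun j => g j y * c j) l - lsum (fun j => g j x * c j) l)) by ring.
  eapply Rle_lt_trans; [apply Rabs_triang|]. rewrite Rabs_mult.
  generalize (Rabs_pos (c i)). nra.
Qed.

Definition is_convolution {G : LCAGroup} (f w F : G -> R) : Prop :=
  forall x, HasSum (fun y => f (gsub x y) * w y) (F x).

Lemma is_convolution_translate_sub {G : LCAGroup} (f w F : G -> R) t :
  is_convolution f w F ->
  is_convolution f (fun y => w (gadd y t) - w y) (fun x => F (gadd x t) - F x).
Proof.
intros conv x.
assert (sum := HasSum_minus _ _ _ _ (HasSum_translate _ _ t (conv (gadd x t))) (conv x)).
replace (fun y => f (gsub x y) * (w (gadd y t) - w y))
  with (fun y => f (gsub (gadd x t) (gadd y t)) * w (gadd y t) - f (gsub x y) * w y); trivial.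
extensionality y.
replace (gsub (gadd x t) (gadd y t)) with (gsub x y) by abel. ring.
Qed.

Section Convolution.
Variables (G : LCAGroup) (K : G -> Prop) (f : G -> R).
Hypothesis f_support : forall x, ~ K x -> f x = 0.

Lemma convolution_term_support (v : G -> R) x y :
  f (gsub x y) * v y <> 0 -> v y <> 0 /\ K (gsub x y).
Proof.
intros term_neq0. split.
- intros E. apply term_neq0. rewrite E. ring.
- apply NNPP. intros notK. apply term_neq0. rewrite (f_support _ notK). ring.
Qed.

Lemma convolution_bound (v F : G -> R) N M e :
  is_convolution f v F ->
  meets_translates_at_most (fun y => v y <> 0) (fun z => K (gopp z)) N ->
  0 <= M -> 0 <= e -> (forall x, Rabs (f x) <= M) -> (forall x, Rabs (v x) <= e) ->
  forall x, Rabs (F x) <= INR N * (M * e).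
Proof.
intros conv meets M_ge0 e_ge0 f_le v_le x. destruct (meets x) as (l & short & listed).
assert (Me_ge0 : 0 <= M * e) by now apply Rmult_le_pos.
apply Rle_trans with (INR (length l) * (M * e)).
- apply (HasSum_le_support _ _ _ _ Me_ge0 (conv x)).
  + intros y. rewrite Rabs_mult. apply Rmult_le_compat; auto using Rabs_pos.
  + intros y term_neq0. destruct (convolution_term_support v x y term_neq0).
    apply listed; trivial. now replace (gopp (gsub y x)) with (gsub x y) by abel.
- apply le_INR in short. now apply Rmult_le_compat_r.
Qed.

Variables (L : G -> Prop) (w : G -> R).
Hypothesis L_discrete : uniformly_discrete G L.
Hypothesis K_bounded : totally_bounded K.
Hypothesis w_support : forall x, ~ L x -> w x = 0.

Lemma convolution_locally_finite_sum (B : G -> Prop) x0 :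
  totally_bounded B ->
  exists l, forall x, B (gsub x x0) ->
    HasSum (fun y => f (gsub x y) * w y) (lsum (fun y => f (gsub x y) * w y) l).
Proof.
intros tbB.
destruct (uniformly_discrete_meets L _ L_discrete (totally_bounded_sub B K tbB K_bounded))
  as [N meets].
destruct (meets x0) as (l & _ & listed). exists (nodup classic_dec l). intros x Bx.
apply HasSum_finite. intros y term_neq0.
destruct (convolution_term_support w x y term_neq0) as [wy_neq0 Kxy].
apply listed; [now apply (nonzero_weight_in L w)|].
exists (gsub x x0), (gsub x y). repeat split; trivial. abel.
Qed.

Lemma convolution_exists : exists F, is_convolution f w F.
Proof.
apply (choice (fun x s => HasSum (fun y => f (gsub x y) * w y) s)). intros x.
destruct (convolution_locally_finite_sum _ x (totally_bounded_list [gzero])) as [l sum].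
exists (lsum (fun y => f (gsub x y) * w y) l). apply sum. left. now rewrite gsub_diag.
Qed.

Lemma convolution_continuous F :
  continuous_fun G f -> is_convolution f w F -> continuous_fun G F.
Proof.
intros cont conv x0 eps eps_pos.
destruct (compact_nbhd_zero G) as (U & N & nbhdU & UN & compN).
destruct (convolution_locally_finite_sum U x0) as [l sum].
{ apply (totally_bounded_subset U N); trivial. now apply compact_totally_bounded. }
assert (F_eq : forall x, U (gsub x x0) -> F x = lsum (fun y => f (gsub x y) * w y) l).
{ intros x Ux. apply (HasSum_unique _ _ _ (conv x)). auto. }
destruct (continuous_at_lsum (fun y x => f (gsub x y)) w l x0) with (eps := eps)
  as (V & openV & Vx0 & close); trivial.
{ intros y d d_pos. destruct (cont (gsub x0 y) d d_pos) as (V & openV & Vx0 & close).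
  exists (fun x => V (gsub x y)). repeat split; auto. now apply gopen_translate. }
destruct (open_nbhd_zero_translate U x0 nbhdU) as [open_x0 Ux0x0].
exists (fun x => U (gsub x x0) /\ V x). repeat split; trivial; [now apply gopen_inter|].
intros x [Ux Vx]. rewrite (F_eq x Ux), (F_eq x0); auto.
Qed.
End Convolution.

Lemma strongly_ap_of_sup_ap {G : LCAGroup} (L : G -> Prop) (w : G -> R) :
  uniformly_discrete G L -> (forall x, ~ L x -> w x = 0) -> sup_ap G w -> strongly_ap G w.
Proof.
intros udL support sap f cont csf.
destruct (compact_support_bounded f cont csf) as (M & M_ge0 & f_le).
destruct csf as (K & compK & f_support). apply compact_totally_bounded in compK.
destruct (convolution_exists G K f f_support L w) as [F conv]; trivial.
exists F. split; trivial. split; [now apply (convolution_continuous G K f f_support L w)|].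
intros eps eps_pos.
destruct (uniformly_discrete_meets L _ udL (totally_bounded_opp K compK)) as [N meets].
assert (factor_ge0 : 0 <= INR (N + N) * M) by (apply Rmult_le_pos; trivial; apply pos_INR).
destruct (exists_small_factor _ eps factor_ge0 eps_pos) as (d & d_pos & small).
apply (relatively_dense_superset _ _) with (2 := sap d d_pos).
intros t (e & e_lt & close). assert (e_ge0 := Rabs_bound_ge0 _ _ close).
exists (INR (N + N) * (M * e)). split; [nra|].
apply (convolution_bound G K f f_support (fun y => w (gadd y t) - w y)); trivial.
- now apply is_convolution_translate_sub.
- now apply (meets_translates_of_shifted_difference L).
- intros x. rewrite gaddC. apply close.
Qed.

Lemma diffset_opp {G : LCAGroup} (L : G -> Prop) r : diffset G L r -> diffset G L (gopp r).
Proof. intros (a & b & La & Lb & ->). exists b, a. repeat split; trivial. abel. Qed.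

(* An almost period [t] of the convolution need not be one of the measure; but each
   point [x] of large weight has a point [y] of the support with [x + t - y] small,
   and since [L - L] is uniformly discrete all the differences [y - x] coincide:
   this common value is an almost period [r] of the measure. *)
Section RecoverWeights.
Variables (G : LCAGroup) (L : G -> Prop) (w f F : G -> R) (U V : G -> Prop).
Hypothesis U_separates :
  forall x y, diffset G L x -> diffset G L y -> U (gsub x y) -> x = y.
Hypothesis V_zero : V gzero.
Hypothesis V_symmetric : symmetric_set V.
Hypothesis V_sub : forall x y, V x -> V y -> U (gsub x y).
Hypothesis w_ge0 : forall x, 0 <= w x.
Hypothesis w_support : forall x, ~ L x -> w x = 0.
Hypothesis f_range : forall x, 0 <= f x <= 1.
Hypothesis f_zero : f gzero = 1.
Hypothesis f_support : forall x, f x <> 0 -> V x.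
Hypothesis F_convolution : is_convolution f w F.

Lemma unique_near_point x y z : L x -> L y -> V (gsub z x) -> V (gsub z y) -> x = y.
Proof.
intros Lx Ly Vzx Vzy. apply gsub_eq_zero, U_separates.
- now exists x, y.
- exists x, x. now rewrite gsub_diag.
- replace (gsub (gsub x y) gzero) with (gsub (gsub z y) (gsub z x)) by abel. auto.
Qed.

Lemma nonzero_term_near x y : f (gsub x y) * w y <> 0 -> L y /\ V (gsub x y).
Proof.
intros term_neq0. split.
- apply (nonzero_weight_in L w); trivial. intros E. apply term_neq0. rewrite E. ring.
- apply f_support. intros E. apply term_neq0. rewrite E. ring.
Qed.

Lemma convolution_single_term x y : L y -> V (gsub x y) -> F x = f (gsub x y) * w y.
Proof.
intros Ly Vxy. apply (HasSum_unique _ _ _ (F_convolution x)).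
replace (f (gsub x y) * w y)
  with (lsum (fun y => f (gsub x y) * w y) (nodup classic_dec [y])) by (simpl; ring).
apply HasSum_finite. intros z term_neq0. left.
apply nonzero_term_near in term_neq0. now apply (unique_near_point y z x).
Qed.

Lemma convolution_at_support x : L x -> F x = w x.
Proof.
intros Lx. rewrite (convolution_single_term x x), gsub_diag, f_zero; trivial; [ring|].
now rewrite gsub_diag.
Qed.

Lemma convolution_pos_near_support x :
  0 < F x -> exists y, L y /\ V (gsub x y) /\ F x <= w y.
Proof.
intros Fx_pos. destruct (classic (exists y, L y /\ V (gsub x y))) as [(y & Ly & Vxy)|isolated].
- exists y. repeat split; trivial. rewrite (convolution_single_term x y); trivial.
  generalize (f_range (gsub x y)) (w_ge0 y). nra.
- assert (F x = lsum (fun y => f (gsub x y) * w y) (nodup classic_dec [])) as E.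
  { apply (HasSum_unique _ _ _ (F_convolution x)), HasSum_finite.
    intros y term_neq0. destruct isolated. exists y. now apply nonzero_term_near. }
  simpl in E. lra.
Qed.

Lemma large_weight_moves t e x :
  (forall x, Rabs (F (gadd x t) - F x) <= e) -> 0 <= e < w x ->
  exists y, L y /\ V (gsub (gadd x t) y) /\ w x - e <= w y.
Proof.
intros close [e_ge0 e_lt].
assert (Fx : F x = w x) by (apply convolution_at_support, (nonzero_weight_in L w); trivial; lra).
specialize (close x). apply Rabs_le_inv in close.
destruct (convolution_pos_near_support (gadd x t)) as (y & Ly & Vy & F_le); [lra|].
exists y. repeat split; trivial. lra.
Qed.

Lemma weight_decrease_along_difference t r e x :
  (forall x, Rabs (F (gadd x t) - F x) <= e) -> 0 <= e ->
  diffset G L r -> V (gsub t r) -> w x - e <= w (gadd r x).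
Proof.
intros close e_ge0 diff_r Vtr. destruct (Rle_lt_dec (w x) e) as [small|large].
- generalize (w_ge0 (gadd r x)). lra.
- destruct (large_weight_moves t e x) as (y & Ly & Vy & w_le); trivial; [lra|].
  assert (Lx : L x) by (apply (nonzero_weight_in L w); trivial; lra).
  rewrite (U_separates r (gsub y x)); trivial.
  + now rewrite gsub_add.
  + now exists y, x.
  + replace (gsub r (gsub y x)) with (gsub (gsub (gadd x t) y) (gsub t r)) by abel. auto.
Qed.

Lemma recovered_almost_period t r e :
  (forall x, Rabs (F (gadd x t) - F x) <= e) -> diffset G L r -> V (gsub t r) ->
  forall x, Rabs (w (gadd r x) - w x) <= e.
Proof.
intros close diff_r Vtr x. assert (e_ge0 := Rabs_bound_ge0 _ _ close).
assert (down := weight_decrease_along_difference t r e x close e_ge0 diff_r Vtr).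
assert (up : w (gadd r x) - e <= w (gadd (gopp r) (gadd r x))).
{ apply (weight_decrease_along_difference (gopp t)); trivial.
  - intros y. rewrite Rabs_minus_sym.
    replace y with (gadd (gadd y (gopp t)) t) at 1 by abel. apply close.
  - now apply diffset_opp.
  - replace (gsub (gopp t) (gopp r)) with (gopp (gsub t r)) by abel. auto. }
replace (gadd (gopp r) (gadd r x)) with x in up by abel. apply Rabs_le. lra.
Qed.

Lemma difference_near_almost_period t e x :
  (forall x, Rabs (F (gadd x t) - F x) <= e) -> e < w x ->
  exists r, diffset G L r /\ V (gsub t r).
Proof.
intros close e_lt. assert (e_ge0 := Rabs_bound_ge0 _ _ close).
destruct (large_weight_moves t e x) as (y & Ly & Vy & _); trivial; [lra|].
exists (gsub y x). split.
- exists y, x. repeat split; trivial. apply (nonzero_weight_in L w); trivial. lra.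
- now replace (gsub t (gsub y x)) with (gsub (gadd x t) y) by abel.
Qed.
End RecoverWeights.

Lemma sup_ap_of_strongly_ap {G : LCAGroup} (L : G -> Prop) (w : G -> R) :
  uniformly_discrete G (diffset G L) -> (forall x, 0 <= w x) -> (forall x, ~ L x -> w x = 0) ->
  nonzero_measure G w -> strongly_ap G w -> sup_ap G w.
Proof.
intros (U & openU & U0 & separates) w_ge0 support [x0 w_neq0] sap eps eps_pos.
destruct (compact_nbhd_zero G) as (B & C & nbhdB & BC & compC).
destruct (open_nbhd_zero_sub (fun x => U x /\ B x)) as (V & nbhdV & symV & V_sub).
{ now apply open_nbhd_zero_inter. }
assert (VC : forall x, V x -> C x).
{ intros x Vx. apply BC. rewrite <- (gsub_zero_r x). apply V_sub; trivial. apply nbhdV. }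
destruct (uniformly_continuous_bump V nbhdV) as (f & f_range & f_zero & f_support & unif).
destruct (sap f) as (F & conv & _ & ap).
{ now apply uniformly_continuous_continuous. }
{ exists C. split; trivial. intros x notCx. apply NNPP. auto. }
assert (w_pos : 0 < w x0) by (specialize (w_ge0 x0); lra).
assert (V_sub_U : forall x y, V x -> V y -> U (gsub x y)) by (intros; now apply V_sub).
destruct nbhdV as [_ V_zero].
assert (eps'_pos : 0 < Rmin eps (w x0)) by now apply Rmin_glb_lt.
apply (relatively_dense_near _ _ V (ap _ eps'_pos)).
{ apply (totally_bounded_subset V C); trivial. now apply compact_totally_bounded. }
intros t (e & e_lt & close). generalize (Rmin_l eps (w x0)) (Rmin_r eps (w x0)). intros.
destruct (difference_near_almost_period G L w f F U V) with (t := t) (e := e) (x := x0)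
  as (r & diff_r & Vtr); trivial; [lra|].
exists r. split; trivial. exists e. split; [lra|].
now apply (recovered_almost_period G L w f F U V) with (t := t).
Qed.

(** * Model sets carry almost periodic measures *)

Section CutAndProject.
Variables (G H : LCAGroup) (Lt : (G * H)%type -> Prop).

Definition lattice_discrete : Prop :=
  exists O, prod_open G H O /\ O (gzero, gzero) /\
    forall p, Lt p -> O p -> p = (gzero, gzero).

Definition lattice_cocompact : Prop :=
  exists C, is_compact (prod_open G H) C /\
    forall p, exists c q, C c /\ Lt q /\
      p = (gadd (fst c) (fst q), gadd (snd c) (snd q)).

Definition internal_projection_dense : Prop :=
  forall V, gopen H V -> (exists h, V h) -> exists p, Lt p /\ V (snd p).

Definition cut_and_project (B : H -> Prop) (x : G) : Prop := exists h, Lt (x, h) /\ B h.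

Hypothesis Lt_add :
  forall p q, Lt p -> Lt q -> Lt (gadd (fst p) (fst q), gadd (snd p) (snd q)).
Hypothesis Lt_opp : forall p, Lt p -> Lt (gopp (fst p), gopp (snd p)).

Lemma lattice_sub x y h k : Lt (x, h) -> Lt (y, k) -> Lt (gsub x y, gsub h k).
Proof. intros Lx Ly. exact (Lt_add _ _ Lx (Lt_opp _ Ly)). Qed.

Lemma cut_and_project_diffset (B : H -> Prop) x :
  diffset G (cut_and_project B) x -> cut_and_project (diffset H B) x.
Proof.
intros (a & b & (h & La & Bh) & (k & Lb & Bk) & ->).
exists (gsub h k). split; [now apply lattice_sub|now exists h, k].
Qed.

Lemma cut_and_project_locally_finite (B : H -> Prop) :
  lattice_discrete -> totally_bounded B -> locally_finite G (cut_and_project B).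
Proof.
intros (O & openO & O0 & isolated) tbB K compK.
destruct (openO _ O0) as (U & V & openU & openV & U0 & V0 & UV). simpl in U0, V0.
destruct (open_nbhd_zero_sub U) as (U' & nbhdU' & _ & U'_sub); [easy|].
destruct (open_nbhd_zero_sub V) as (V' & nbhdV' & _ & V'_sub); [easy|].
destruct (compact_totally_bounded K compK U' nbhdU') as [cs netK].
destruct (tbB V' nbhdV') as [ds netB].
destruct (finite_of_injective_cover (fun p => Lt p /\ K (fst p) /\ B (snd p))
            (fun c p => U' (gsub (fst p) (fst c)) /\ V' (gsub (snd p) (snd c)))
            (list_prod cs ds)) as (l & _ & listed).
- intros [x h] (_ & Kx & Bh). destruct (netK x Kx) as (c & In_c & Uxc).
  destruct (netB h Bh) as (d & In_d & Vhd).
  exists (c, d). split; [now apply in_prod|easy].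
- intros [c d] [x h] [y k] (Lx & _) (Ly & _) [Ux Vh] [Uy Vk]. simpl in *.
  assert (E : (gsub x y, gsub h k) = (gzero, gzero)).
  { apply isolated; [now apply lattice_sub|]. apply UV.
    - replace (gsub x y) with (gsub (gsub x c) (gsub y c)) by abel. auto.
    - replace (gsub h k) with (gsub (gsub h d) (gsub k d)) by abel. auto. }
  injection E as Ex Eh. f_equal; now apply gsub_eq_zero.
- exists (map fst l). intros x (h & Lx & Bh) Kx. now apply (in_map fst l (x, h)), listed.
Qed.

Lemma cut_and_project_flc (B : H -> Prop) :
  lattice_discrete -> totally_bounded B -> finite_local_complexity G (cut_and_project B).
Proof.
intros discrete tbB. apply (locally_finite_subset _ (cut_and_project (diffset H B))).
- apply cut_and_project_diffset.
- apply cut_and_project_locally_finite; trivial. now apply totally_bounded_sub.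
Qed.

Lemma compact_projections_totally_bounded C :
  is_compact (prod_open G H) C ->
  totally_bounded (fun x => exists c, C c /\ x = fst c) /\
  totally_bounded (fun h => exists c, C c /\ h = snd c).
Proof.
intros compC. split; apply compact_totally_bounded, (compact_image (prod_open G H));
  trivial; intros U openU c Uc.
- exists U, (fun _ => True). repeat split; trivial. apply gopen_full.
- exists (fun _ => True), U. repeat split; trivial. apply gopen_full.
Qed.

Lemma compact_in_lattice_translates (D : H -> Prop) V :
  internal_projection_dense -> totally_bounded D -> open_nbhd_zero V ->
  exists m, forall h, D h -> exists p, In p m /\ Lt p /\ V (gsub (snd p) h).
Proof.
intros dense tbD nbhdV. destruct (totally_bounded_in_compact D tbD) as (K & compK & DK).
destruct (compact_in_ideal (gopen H) K (fun A => exists m, forall h, A h ->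
            exists p, In p m /\ Lt p /\ V (gsub (snd p) h))) as [m net]; trivial.
- apply (net_ideal (fun p h => Lt p /\ V (gsub (snd p) h))).
- intros h _. destruct (open_nbhd_zero_sub V nbhdV) as (V' & nbhdV' & _ & V'_sub).
  destruct (open_nbhd_zero_translate V' h nbhdV') as [open_h Vhh].
  destruct (dense (fun k => V' (gsub k h)) open_h) as (p & Lp & Vp); [now exists h|].
  exists (fun k => V' (gsub k h)). repeat split; trivial.
  exists [p]. intros k Vk. exists p. split; [now left|]. split; trivial.
  replace (gsub (snd p) k) with (gsub (gsub (snd p) h) (gsub k h)) by abel. auto.
- exists m. auto.
Qed.

Lemma cut_and_project_relatively_dense (V : H -> Prop) :
  lattice_cocompact -> internal_projection_dense -> open_nbhd_zero V ->
  relatively_dense G (cut_and_project V).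
Proof.
intros (C & compC & cocompact) dense nbhdV.
destruct (compact_projections_totally_bounded C compC) as [tb_fst tb_snd].
destruct (compact_in_lattice_translates _ V dense tb_snd nbhdV) as [m net].
apply (relatively_dense_of_totally_bounded _
         (set_sub (fun x => exists c, C c /\ x = fst c) (fun x => In x (map fst m)))).
{ apply totally_bounded_sub; trivial. apply totally_bounded_list. }
intros g. destruct (cocompact (g, gzero)) as (c & q & Cc & Lq & E). injection E as Eg Eh.
destruct (net (snd c)) as (p & In_p & Lp & Vp); [now exists c|].
exists (gadd (fst q) (fst p)). split.
- exists (gadd (snd q) (snd p)). split; [now apply Lt_add|].
  replace (gadd (snd q) (snd p)) with (gsub (snd p) (snd c)); trivial.
  transitivity (gsub (gadd (snd p) gzero) (snd c)); [abel|rewrite Eh; abel].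
- exists (fst c), (fst p). repeat split.
  + now exists c.
  + now apply in_map.
  + rewrite Eg. abel.
Qed.

Hypothesis Lt_injective : forall p q, Lt p -> Lt q -> fst p = fst q -> p = q.

Lemma star_map_weights_exist (f : H -> R) :
  exists w : G -> R, (forall x h, Lt (x, h) -> w x = f h) /\
    (forall x, ~ (exists h, Lt (x, h)) -> w x = 0).
Proof.
destruct (choice (fun x r => (forall h, Lt (x, h) -> r = f h) /\
            (~ (exists h, Lt (x, h)) -> r = 0))) as [w Hw].
- intros x. destruct (classic (exists h, Lt (x, h))) as [[h Lh]|off_lattice].
  + exists (f h). split; [|intros not_on; now destruct not_on; exists h].
    intros k Lk. assert (E := Lt_injective _ _ Lh Lk eq_refl). now injection E as <-.
  + exists 0. split; trivial. intros h Lh. now destruct off_lattice; exists h.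
- exists w. split; intros x; apply Hw.
Qed.

Lemma star_map_weights_sup_ap (f : H -> R) (w : G -> R) :
  lattice_cocompact -> internal_projection_dense -> uniformly_continuous f ->
  (forall x h, Lt (x, h) -> w x = f h) ->
  (forall x, ~ (exists h, Lt (x, h)) -> w x = 0) -> sup_ap G w.
Proof.
intros cocompact dense unif on_lattice off_lattice eps eps_pos.
destruct (unif (eps / 2)) as (V & nbhdV & close); [lra|].
apply (relatively_dense_superset (cut_and_project V));
  [|now apply cut_and_project_relatively_dense].
intros t (k & Lk & Vk). exists (eps / 2). split; [lra|]. intros x.
destruct (classic (exists h, Lt (x, h))) as [[h Lh]|not_on].
- rewrite (on_lattice x h Lh), (on_lattice (gadd t x) (gadd k h)) by exact (Lt_add _ _ Lk Lh).
  rewrite gaddC. auto.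
- rewrite (off_lattice x not_on), off_lattice, Rminus_diag, Rabs_R0; [lra|].
  intros [h Lh]. apply not_on. exists (gsub h k).
  replace x with (gsub (gadd t x) t) by abel. now apply lattice_sub.
Qed.
End CutAndProject.

Lemma model_set_flc {G : LCAGroup} (L : G -> Prop) :
  model_set G L -> finite_local_complexity G L.
Proof.
intros (H & Lt & W & _ & add & opp & disc & _ & _ & _ & compW & _ & L_eq).
apply (locally_finite_subset _ (diffset G (cut_and_project G H Lt W))).
- apply diffset_subset. intros x. apply L_eq.
- apply cut_and_project_flc; trivial. now apply totally_bounded_of_compact_closure.
Qed.

Lemma model_set_diffset_uniformly_discrete {G : LCAGroup} (L : G -> Prop) :
  model_set G L -> uniformly_discrete G (diffset G L).
Proof.
intros (H & Lt & W & _ & add & opp & disc & _ & _ & _ & compW & _ & L_eq).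
apply flc_uniformly_discrete.
apply (locally_finite_subset _ (diffset G (cut_and_project G H Lt (diffset H W)))).
- apply diffset_subset. intros x LLx. apply cut_and_project_diffset; trivial.
  revert LLx. apply diffset_subset. intros y. apply L_eq.
- apply totally_bounded_of_compact_closure in compW.
  apply cut_and_project_flc; trivial. now apply totally_bounded_sub.
Qed.

Definition carries_measure (G : LCAGroup) (L : G -> Prop) (P : (G -> R) -> Prop) : Prop :=
  exists w, pos_measure_below_delta G L w /\ nonzero_measure G w /\ P w.

Lemma model_set_carries_sup_ap {G : LCAGroup} (L : G -> Prop) :
  model_set G L -> carries_measure G L (sup_ap G).
Proof.
intros (H & Lt & W & _ & add & opp & _ & cocompact & inj & dense & _ & interior & L_eq).
destruct interior as (Q & openQ & [h0 Qh0] & QW).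
destruct (uniformly_continuous_bump (fun v => Q (gadd v h0)))
  as (f & f_range & f_zero & f_support & unif).
{ split; [now apply gopen_translate|now rewrite gadd0]. }
destruct (star_map_weights_exist G H Lt inj (fun h => f (gsub h h0)))
  as (w & on_lattice & off_lattice).
assert (w_range : forall x, 0 <= w x <= 1).
{ intros x. destruct (classic (exists h, Lt (x, h))) as [[h Lh]|off].
  - now rewrite (on_lattice x h Lh).
  - rewrite (off_lattice x off). lra. }
exists w. split; [|split].
- split; [intros; apply w_range|]. split; [intros; apply w_range|]. intros x notLx.
  destruct (classic (exists h, Lt (x, h))) as [[h Lh]|off]; auto.
  rewrite (on_lattice x h Lh). apply NNPP. intros f_neq0. apply notLx, L_eq.
  exists h. split; trivial. apply QW. rewrite <- (gsub_add h h0). auto.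
- destruct (unif (/ 2)) as (V & nbhdV & close); [lra|].
  destruct (open_nbhd_zero_translate V h0 nbhdV) as [open_h0 Vh0].
  destruct (dense (fun h => V (gsub h h0)) open_h0) as ([x h] & Lx & Vh); [now exists h0|].
  exists x. rewrite (on_lattice x h Lx). specialize (close _ gzero Vh).
  rewrite gadd0, f_zero in close. simpl in close. apply Rabs_le_inv in close. lra.
- apply (star_map_weights_sup_ap G H Lt add opp (fun h => f (gsub h h0))); trivial.
  intros eps eps_pos. destruct (unif eps eps_pos) as (V & nbhdV & close).
  exists V. split; trivial. intros v h Vv.
  replace (gsub (gadd h v) h0) with (gadd (gsub h h0) v) by abel. auto.
Qed.

(** * Uniform convergence *)

Lemma intervals_common_point {I : Type} (i0 : I) (c r : I -> R) :
  (forall i j, Rabs (c i - c j) <= r i + r j) -> exists z, forall i, Rabs (z - c i) <= r i.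
Proof.
intros overlap.
destruct (completeness (fun y => exists i, y = c i - r i)) as [z [upper least]].
- exists (c i0 + r i0). intros y [i ->]. specialize (overlap i i0).
  apply Rabs_le_inv in overlap. lra.
- exists (c i0 - r i0). now exists i0.
- exists z. intros i. apply Rabs_le. split.
  + assert (c i - r i <= z) by (apply upper; now exists i). lra.
  + assert (z <= c i + r i); [|lra]. apply least. intros y [j ->].
    specialize (overlap i j). apply Rabs_le_inv in overlap. lra.
Qed.

Definition sup_dist_le {X : Type} (u v : X -> R) (e : R) : Prop :=
  forall x, Rabs (u x - v x) <= e.

Lemma sup_dist_le_refl {X : Type} (u : X -> R) e : 0 <= e -> sup_dist_le u u e.
Proof. intros e_ge0 x. now rewrite Rminus_diag, Rabs_R0. Qed.

Lemma sup_dist_le_sym {X : Type} (u v : X -> R) e : sup_dist_le u v e -> sup_dist_le v u e.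
Proof. intros uv x. rewrite Rabs_minus_sym. auto. Qed.

Lemma sup_dist_le_trans {X : Type} (u v z : X -> R) d e :
  sup_dist_le u v d -> sup_dist_le v z e -> sup_dist_le u z (d + e).
Proof.
intros uv vz x. replace (u x - z x) with ((u x - v x) + (v x - z x)) by ring.
eapply Rle_trans; [apply Rabs_triang|]. now apply Rplus_le_compat.
Qed.

Lemma sup_dist_le_triangle_l {X : Type} (v u z : X -> R) d e :
  sup_dist_le v u d -> sup_dist_le v z e -> sup_dist_le u z (d + e).
Proof. intros vu. apply sup_dist_le_trans. now apply sup_dist_le_sym. Qed.

Lemma sup_dist_le_weaken {X : Type} (u v : X -> R) d e :
  d <= e -> sup_dist_le u v d -> sup_dist_le u v e.
Proof. intros d_le_e uv x. eapply Rle_trans; eauto. Qed.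

Lemma sup_dist_le_limit {X : Type} (u v : X -> R) e :
  (forall d, 0 < d -> sup_dist_le u v (e + d)) -> sup_dist_le u v e.
Proof. intros uv x. apply le_epsilon. intros d d_pos. now apply uv. Qed.

Lemma sup_dist_le_balls_meet {X I : Type} (i0 : I) (c : I -> X -> R) (r : I -> R) :
  (forall i j, sup_dist_le (c i) (c j) (r i + r j)) ->
  exists z, forall i, sup_dist_le z (c i) (r i).
Proof.
intros overlap. destruct (choice (fun x z => forall i, Rabs (z - c i x) <= r i)) as [z Hz].
- intros x. apply (intervals_common_point i0). intros i j. apply overlap.
- exists z. intros i x. apply Hz.
Qed.

Section FunctionSpace.
Variables (X : Type) (P : (X -> R) -> Prop).

Definition function_space : Type := {u : X -> R | P u}.
Definition value (u : function_space) : X -> R := proj1_sig u.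
Local Coercion value : function_space >-> Funclass.

Definition uniform_open (O : function_space -> Prop) : Prop :=
  forall u, O u -> exists e, 0 < e /\ forall v : function_space, sup_dist_le u v e -> O v.

Definition uniform_ball (u : function_space) (e : R) (v : function_space) : Prop :=
  exists r, r < e /\ sup_dist_le u v r.

Lemma function_space_ext (u v : function_space) :
  (forall e, 0 < e -> sup_dist_le u v e) -> u = v.
Proof.
intros close. destruct u as [u Pu], v as [v Pv].
assert (E : u = v).
{ extensionality x. apply cond_eq. intros e e_pos.
  apply Rle_lt_trans with (e / 2); [|lra]. apply (close (e / 2)); lra. }
subst v. f_equal. apply proof_irrelevance.
Qed.

Lemma uniform_ball_open u e : uniform_open (uniform_ball u e).
Proof.
intros v (r & r_lt & uv). exists ((e - r) / 2). split; [lra|]. intros z vz.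
exists (r + (e - r) / 2). split; [lra|]. now apply sup_dist_le_trans with v.
Qed.

Lemma uniform_ball_center u e : 0 < e -> uniform_ball u e u.
Proof. intros e_pos. exists 0. split; trivial. apply sup_dist_le_refl. lra. Qed.

Lemma uniform_open_full : uniform_open (fun _ => True).
Proof. intros u _. exists 1. split; [lra|easy]. Qed.

Lemma uniform_open_inter U V :
  uniform_open U -> uniform_open V -> uniform_open (fun x => U x /\ V x).
Proof.
intros openU openV u [Uu Vu]. destruct (openU u Uu) as (d & d_pos & ball_d).
destruct (openV u Vu) as (e & e_pos & ball_e). exists (Rmin d e).
split; [now apply Rmin_glb_lt|]. intros v uv. split.
- apply ball_d. apply (sup_dist_le_weaken _ _ (Rmin d e)); trivial. apply Rmin_l.
- apply ball_e. apply (sup_dist_le_weaken _ _ (Rmin d e)); trivial. apply Rmin_r.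
Qed.

Lemma uniform_open_union (F : (function_space -> Prop) -> Prop) :
  (forall U, F U -> uniform_open U) -> uniform_open (fun x => exists U, F U /\ U x).
Proof.
intros openF u (U & FU & Uu). destruct (openF U FU u Uu) as (e & e_pos & ball_e).
exists e. split; trivial. intros v uv. exists U. auto.
Qed.

Lemma uniform_hausdorff (u v : function_space) : u <> v ->
  exists U V, uniform_open U /\ uniform_open V /\ U u /\ V v /\
    forall z, U z -> V z -> False.
Proof.
intros u_neq_v.
assert (exists e, 0 < e /\ ~ sup_dist_le u v e) as (e & e_pos & far).
{ apply NNPP. intros close. apply u_neq_v, function_space_ext. intros e e_pos.
  apply NNPP. intros far. apply close. now exists e. }
exists (uniform_ball u (e / 2)), (uniform_ball v (e / 2)).
repeat split; try apply uniform_ball_open; try (apply uniform_ball_center; lra).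
intros z (r & r_lt & uz) (s & s_lt & vz). apply far.
apply (sup_dist_le_weaken _ _ (r + s)); [lra|].
apply sup_dist_le_trans with z; trivial. now apply sup_dist_le_sym.
Qed.

Definition uniformly_totally_bounded (A : function_space -> Prop) : Prop :=
  forall e, 0 < e -> exists l : list (X -> R),
    forall u : function_space, A u -> exists c, In c l /\ sup_dist_le u c e.

Definition uniformly_closed (A : function_space -> Prop) : Prop :=
  forall u : function_space,
    (forall e, 0 < e -> exists v : function_space, A v /\ sup_dist_le u v e) -> A u.

Lemma uncovered_part (F : (function_space -> Prop) -> Prop) (A S : function_space -> Prop) e :
  uniformly_totally_bounded A -> 0 < e -> (forall u, S u -> A u) -> ~ finitely_covered F S ->
  exists c, ~ finitely_covered F (fun u => S u /\ sup_dist_le u c e).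
Proof.
intros tb e_pos SA uncovered. apply NNPP. intros all_covered. apply uncovered.
destruct (tb e e_pos) as [l net]. destruct (finitely_covered_ideal F) as [_ subset _].
apply (subset _ (fun u => exists c, In c l /\ S u /\ sup_dist_le u c e)).
- intros u Su. destruct (net u (SA u Su)) as (c & In_c & uc). now exists c.
- apply (ideal_list_union (finitely_covered F)
           (fun c (u : function_space) => S u /\ sup_dist_le u c e)).
  + apply finitely_covered_ideal.
  + intros c _. apply NNPP. intros uncovered_c. apply all_covered. now exists c.
Qed.

Lemma shrinking_uncovered_sets (F : (function_space -> Prop) -> Prop) A :
  uniformly_totally_bounded A -> ~ finitely_covered F A ->
  exists S : nat -> function_space -> Prop,
    (forall n, ~ finitely_covered F (S n)) /\ (forall n u, S n u -> A u) /\
    (forall m n u, (m <= n)%nat -> S n u -> S m u) /\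
    forall n, exists c, forall u, S (Datatypes.S n) u -> sup_dist_le u c ((/ 2) ^ n).
Proof.
intros tb uncoveredA.
set (bad := fun S : function_space -> Prop =>
  ~ finitely_covered F S /\ forall u, S u -> A u).
destruct (dependent_choice (fun p q : nat * (function_space -> Prop) =>
    fst q = S (fst p) /\ (bad (snd p) -> bad (snd q) /\ (forall u, snd q u -> snd p u) /\
      exists c, forall u, snd q u -> sup_dist_le u c ((/ 2) ^ fst p))) (O, A))
  as (p & p_O & p_step).
{ intros [n S]. destruct (classic (bad S)) as [[uncovered SA]|not_bad].
  - destruct (uncovered_part F A S ((/ 2) ^ n)) as [c uncovered_c]; trivial.
    { apply pow_half_pos. }
    exists (Datatypes.S n, fun u => S u /\ sup_dist_le u c ((/ 2) ^ n)).
    split; trivial. intros _. split; [split; trivial; intros u []; auto|].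
    split; [now intros u []|]. exists c. now intros u [].
  - exists (Datatypes.S n, S). easy. }
assert (index : forall n, fst (p n) = n).
{ induction n as [|n IH]; [now rewrite p_O|]. destruct (p_step n) as [E _]. congruence. }
assert (all_bad : forall n, bad (snd (p n))).
{ induction n as [|n IH]; [now rewrite p_O|now apply p_step]. }
exists (fun n => snd (p n)). split; [|split; [|split]].
- intros n. apply all_bad.
- intros n. apply all_bad.
- intros m n u. induction 1 as [|n _ IH]; trivial. intros Su. now apply IH, p_step.
- intros n. destruct (p_step n) as [_ shrink].
  destruct (shrink (all_bad n)) as (_ & _ & c & near). exists c. now rewrite index in near.
Qed.

Hypothesis P_closed :
  forall u, (forall e, 0 < e -> exists v, P v /\ sup_dist_le u v e) -> P u.

Lemma limit_of_shrinking_sets (A : function_space -> Prop)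
    (S : nat -> function_space -> Prop) :
  uniformly_closed A -> (forall n, exists u, S n u) -> (forall n u, S n u -> A u) ->
  (forall m n u, (m <= n)%nat -> S n u -> S m u) ->
  (forall n, exists c, forall u, S (Datatypes.S n) u -> sup_dist_le u c ((/ 2) ^ n)) ->
  exists z, A z /\ forall e, 0 < e -> exists n, forall u, S n u -> sup_dist_le z u e.
Proof.
intros closed nonempty SA nested shrink.
destruct (choice _ shrink) as [c near]. clear shrink.
destruct (sup_dist_le_balls_meet O c (fun n => (/ 2) ^ n)) as [z zc].
{ intros i j. destruct (nonempty (Datatypes.S (i + j))) as [u Su].
  apply sup_dist_le_triangle_l with u; apply near;
    apply (nested _ (Datatypes.S (i + j))); trivial; lia. }
assert (zS : forall e, 0 < e -> exists n, forall u, S n u -> sup_dist_le z u e).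
{ intros e e_pos. destruct (pow_half_small (e / 2)) as [n small]; [lra|].
  exists (Datatypes.S n). intros u Su.
  apply (sup_dist_le_weaken _ _ ((/ 2) ^ n + (/ 2) ^ n)); [lra|].
  apply sup_dist_le_trans with (c n); trivial. apply sup_dist_le_sym. auto. }
assert (zA : forall e, 0 < e -> exists v : function_space, A v /\ sup_dist_le z v e).
{ intros e e_pos. destruct (zS e e_pos) as [n zn]. destruct (nonempty n) as [u Su].
  exists u. eauto. }
assert (Pz : P z).
{ apply P_closed. intros e e_pos. destruct (zA e e_pos) as ([v Pv] & _ & zv).
  now exists v. }
exists (exist _ z Pz). split; trivial. now apply closed.
Qed.

Lemma closed_totally_bounded_compact A :
  uniformly_closed A -> uniformly_totally_bounded A -> is_compact uniform_open A.
Proof.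
intros closed tb F openF cover. apply NNPP. intros uncovered.
destruct (shrinking_uncovered_sets F A tb uncovered)
  as (S & uncoveredS & SA & nested & shrink).
assert (nonempty : forall n, exists u, S n u).
{ intros n. apply NNPP. intros empty. apply (uncoveredS n). exists [].
  split; [now intros ? []|]. intros u Su. destruct empty. now exists u. }
destruct (limit_of_shrinking_sets A S) as (z & Az & near); trivial.
destruct (cover z Az) as (U & FU & Uz). destruct (openF U FU z Uz) as (e & e_pos & ball_e).
destruct (near e e_pos) as [n zn]. apply (uncoveredS n).
apply (ideal_subset _ (finitely_covered_ideal F) _ U); [|now apply finitely_covered_member].
intros u Su. auto.
Qed.
End FunctionSpace.

Arguments value {X P} u _.
Arguments uniform_open {X P} O.
Arguments uniform_ball {X P} u e v.
Coercion value : function_space >-> Funclass.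

(** * The hull of a weight function *)

Section Hull.
Variables (G : LCAGroup) (w : G -> R).

Definition translate (t x : G) : R := w (gadd x t).

Lemma translate_dist_shift s t r e :
  sup_dist_le (translate s) (translate t) e ->
  sup_dist_le (translate (gadd s r)) (translate (gadd t r)) e.
Proof.
intros st x. specialize (st (gadd x r)). unfold translate in *.
replace (gadd x (gadd s r)) with (gadd (gadd x r) s) by abel.
now replace (gadd x (gadd t r)) with (gadd (gadd x r) t) by abel.
Qed.

Lemma translate_dist_add s s' t t' d e :
  sup_dist_le (translate s) (translate s') d -> sup_dist_le (translate t) (translate t') e ->
  sup_dist_le (translate (gadd s t)) (translate (gadd s' t')) (d + e).
Proof.
intros ss' tt'. apply sup_dist_le_trans with (translate (gadd s' t)).
- now apply translate_dist_shift.
- rewrite !(gaddC G s'). now apply translate_dist_shift.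
Qed.

Lemma translate_dist_opp s t e :
  sup_dist_le (translate s) (translate t) e ->
  sup_dist_le (translate (gopp s)) (translate (gopp t)) e.
Proof.
intros st. apply sup_dist_le_sym.
replace (gopp t) with (gadd s (gopp (gadd s t))) by abel.
replace (gopp s) with (gadd t (gopp (gadd s t))) by abel.
now apply translate_dist_shift.
Qed.

Definition in_hull (u : G -> R) : Prop :=
  forall e, 0 < e -> exists t, sup_dist_le u (translate t) e.

Local Notation hull := (function_space G in_hull).

Lemma hull_approx (u : hull) e : 0 < e -> exists t, sup_dist_le u (translate t) e.
Proof. apply (proj2_sig u). Qed.

Lemma in_hull_closed u :
  (forall e, 0 < e -> exists v, in_hull v /\ sup_dist_le u v e) -> in_hull u.
Proof.
intros near e e_pos. destruct (near (e / 2)) as (v & hull_v & uv); [lra|].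
destruct (hull_v (e / 2)) as [t vt]; [lra|]. exists t.
replace e with (e / 2 + e / 2) by field. now apply sup_dist_le_trans with v.
Qed.

Lemma translate_in_hull t : in_hull (translate t).
Proof. intros e e_pos. exists t. apply sup_dist_le_refl. lra. Qed.

Definition hull_of (t : G) : hull := exist _ (translate t) (translate_in_hull t).

Lemma hull_of_dist t e : 0 <= e -> sup_dist_le (hull_of t) (translate t) e.
Proof. intros e_ge0. now apply sup_dist_le_refl. Qed.

Lemma hull_limit {I : Type} (t : I -> G) (r : I -> R) :
  (forall e, 0 < e -> exists i, r i <= e) ->
  (forall i j, sup_dist_le (translate (t i)) (translate (t j)) (r i + r j)) ->
  exists z : hull, forall i, sup_dist_le z (translate (t i)) (r i).
Proof.
intros r_small overlap. destruct (r_small 1) as [i0 _]; [lra|].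
destruct (sup_dist_le_balls_meet i0 (fun i => translate (t i)) r overlap) as [z near].
assert (hull_z : in_hull z).
{ intros e e_pos. destruct (r_small e e_pos) as [i ri]. exists (t i).
  now apply (sup_dist_le_weaken _ _ (r i)). }
now exists (exist _ z hull_z).
Qed.

(* The sum in the hull is the common limit of the sums of all approximations of the
   arguments by translates; taking all of them at once makes the limit independent
   of choices. *)
Lemma hull_add_exists (u v : hull) :
  exists z : hull, forall s t d e,
    sup_dist_le u (translate s) d -> sup_dist_le v (translate t) e ->
    sup_dist_le z (translate (gadd s t)) (d + e).
Proof.
set (I := {p : (G * R) * (G * R) |
            sup_dist_le u (translate (fst (fst p))) (snd (fst p)) /\
            sup_dist_le v (translate (fst (snd p))) (snd (snd p))}).
destruct (hull_limit (I := I)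
  (fun i => gadd (fst (fst (proj1_sig i))) (fst (snd (proj1_sig i))))
  (fun i => snd (fst (proj1_sig i)) + snd (snd (proj1_sig i)))) as [z near].
- intros e e_pos. destruct (hull_approx u (e / 2)) as [s us]; [lra|].
  destruct (hull_approx v (e / 2)) as [t vt]; [lra|].
  exists (exist _ ((s, e / 2), (t, e / 2)) (conj us vt)). simpl. lra.
- intros [[[s d] [t e]] [us vt]] [[[s' d'] [t' e']] [us' vt']]. simpl in *.
  replace (d + e + (d' + e')) with ((d + d') + (e + e')) by ring.
  apply translate_dist_add; eapply sup_dist_le_triangle_l; eassumption.
- exists z. intros s t d e us vt.
  exact (near (exist _ ((s, d), (t, e)) (conj us vt))).
Qed.

Lemma hull_opp_exists (u : hull) :
  exists z : hull, forall s d,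
    sup_dist_le u (translate s) d -> sup_dist_le z (translate (gopp s)) d.
Proof.
set (I := {p : G * R | sup_dist_le u (translate (fst p)) (snd p)}).
destruct (hull_limit (I := I)
  (fun i => gopp (fst (proj1_sig i))) (fun i => snd (proj1_sig i))) as [z near].
- intros e e_pos. destruct (hull_approx u e e_pos) as [s us].
  exists (exist _ (s, e) us). simpl. lra.
- intros [[s d] us] [[s' d'] us']. simpl in *. apply translate_dist_opp.
  eapply sup_dist_le_triangle_l; eassumption.
- exists z. intros s d us. exact (near (exist _ (s, d) us)).
Qed.

Definition hull_add (u v : hull) : hull :=
  proj1_sig (constructive_indefinite_description _ (hull_add_exists u v)).
Definition hull_opp (u : hull) : hull :=
  proj1_sig (constructive_indefinite_description _ (hull_opp_exists u)).

Lemma hull_add_approx (u v : hull) s t d e :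
  sup_dist_le u (translate s) d -> sup_dist_le v (translate t) e ->
  sup_dist_le (hull_add u v) (translate (gadd s t)) (d + e).
Proof.
unfold hull_add. destruct constructive_indefinite_description as [z near]. apply near.
Qed.

Lemma hull_opp_approx (u : hull) s d :
  sup_dist_le u (translate s) d -> sup_dist_le (hull_opp u) (translate (gopp s)) d.
Proof.
unfold hull_opp. destruct constructive_indefinite_description as [z near]. apply near.
Qed.

Lemma hull_eq_of_approx (u v : hull) :
  (forall e, 0 < e ->
     exists t, sup_dist_le u (translate t) e /\ sup_dist_le v (translate t) e) ->
  u = v.
Proof.
intros common. apply function_space_ext. intros e e_pos.
destruct (common (e / 2)) as (t & ut & vt); [lra|].
replace e with (e / 2 + e / 2) by field. apply sup_dist_le_trans with (translate t); trivial.
now apply sup_dist_le_sym.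
Qed.

Lemma hull_addA u v z : hull_add u (hull_add v z) = hull_add (hull_add u v) z.
Proof.
apply hull_eq_of_approx. intros e e_pos.
destruct (hull_approx u (e / 3)) as [r ur]; [lra|].
destruct (hull_approx v (e / 3)) as [s vs]; [lra|].
destruct (hull_approx z (e / 3)) as [t zt]; [lra|].
exists (gadd r (gadd s t)). split.
- replace e with (e / 3 + (e / 3 + e / 3)) by field. auto using hull_add_approx.
- replace e with (e / 3 + e / 3 + e / 3) by field. rewrite gaddA.
  auto using hull_add_approx.
Qed.

Lemma hull_addC u v : hull_add u v = hull_add v u.
Proof.
apply hull_eq_of_approx. intros e e_pos.
destruct (hull_approx u (e / 2)) as [s us]; [lra|].
destruct (hull_approx v (e / 2)) as [t vt]; [lra|].
replace e with (e / 2 + e / 2) by field.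
exists (gadd s t). split; [|rewrite gaddC]; auto using hull_add_approx.
Qed.

Lemma hull_add0 u : hull_add (hull_of gzero) u = u.
Proof.
apply hull_eq_of_approx. intros e e_pos. destruct (hull_approx u e e_pos) as [t ut].
exists t. split; trivial. rewrite <- (gadd0 G t), <- (Rplus_0_l e).
apply hull_add_approx; trivial. apply hull_of_dist. lra.
Qed.

Lemma hull_addN u : hull_add (hull_opp u) u = hull_of gzero.
Proof.
apply hull_eq_of_approx. intros e e_pos. destruct (hull_approx u (e / 2)) as [t ut]; [lra|].
exists gzero. split; [|apply hull_of_dist; lra].
replace e with (e / 2 + e / 2) by field. rewrite <- (gaddN G t).
auto using hull_add_approx, hull_opp_approx.
Qed.

Lemma hull_of_add s t : hull_add (hull_of s) (hull_of t) = hull_of (gadd s t).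
Proof.
apply hull_eq_of_approx. intros e e_pos.
exists (gadd s t). split; [|apply hull_of_dist; lra].
replace e with (e / 2 + e / 2) by field. apply hull_add_approx; apply hull_of_dist; lra.
Qed.

Lemma hull_of_opp t : hull_opp (hull_of t) = hull_of (gopp t).
Proof.
apply hull_eq_of_approx. intros e e_pos.
exists (gopp t). split; [|apply hull_of_dist; lra].
apply hull_opp_approx, hull_of_dist. lra.
Qed.

Lemma hull_add_lipschitz (u u' v v' : hull) d e :
  sup_dist_le u u' d -> sup_dist_le v v' e ->
  sup_dist_le (hull_add u v) (hull_add u' v') (d + e).
Proof.
intros uu' vv'. apply sup_dist_le_limit. intros h h_pos.
destruct (hull_approx u (h / 4)) as [s us]; [lra|].
destruct (hull_approx v (h / 4)) as [t vt]; [lra|].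
replace (d + e + h) with ((h / 4 + h / 4) + ((d + h / 4) + (e + h / 4))) by field.
apply sup_dist_le_trans with (translate (gadd s t)); [now apply hull_add_approx|].
apply sup_dist_le_sym, hull_add_approx; eapply sup_dist_le_triangle_l; eassumption.
Qed.

Lemma hull_opp_lipschitz (u v : hull) e :
  sup_dist_le u v e -> sup_dist_le (hull_opp u) (hull_opp v) e.
Proof.
intros uv. apply sup_dist_le_limit. intros h h_pos.
destruct (hull_approx u (h / 2)) as [s us]; [lra|].
replace (e + h) with (h / 2 + (e + h / 2)) by field.
apply sup_dist_le_trans with (translate (gopp s)); [now apply hull_opp_approx|].
apply sup_dist_le_sym, hull_opp_approx. eapply sup_dist_le_triangle_l; eassumption.
Qed.

Lemma hull_add_continuous u v U : uniform_open U -> U (hull_add u v) ->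
  exists V W, uniform_open V /\ uniform_open W /\ V u /\ W v /\
    forall a b, V a -> W b -> U (hull_add a b).
Proof.
intros openU Uuv. destruct (openU _ Uuv) as (e & e_pos & ball_e).
exists (uniform_ball u (e / 2)), (uniform_ball v (e / 2)).
repeat split; try apply uniform_ball_open; try (apply uniform_ball_center; lra).
intros a b (r & r_lt & ua) (s & s_lt & vb). apply ball_e.
apply (sup_dist_le_weaken _ _ (r + s)); [lra|]. now apply hull_add_lipschitz.
Qed.

Lemma hull_opp_continuous u U : uniform_open U -> U (hull_opp u) ->
  exists V, uniform_open V /\ V u /\ forall a, V a -> U (hull_opp a).
Proof.
intros openU Uu. destruct (openU _ Uu) as (e & e_pos & ball_e). exists (uniform_ball u e).
repeat split; try apply uniform_ball_open; try (now apply uniform_ball_center).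
intros a (r & r_lt & ua). apply ball_e. apply (sup_dist_le_weaken _ _ r); [lra|].
now apply hull_opp_lipschitz.
Qed.

(** * The model set of an almost periodic weight function *)

Definition almost_period (e : R) (t : G) : Prop :=
  sup_dist_le (translate t) (translate gzero) e.

Lemma almost_period_of_translates s t e :
  sup_dist_le (translate s) (translate t) e -> almost_period e (gsub s t).
Proof.
intros st. unfold almost_period. rewrite <- (gsub_diag t). now apply translate_dist_shift.
Qed.

Lemma translates_of_almost_period s t e :
  almost_period e (gsub s t) -> sup_dist_le (translate s) (translate t) e.
Proof.
intros period. apply translate_dist_shift with (r := t) in period.
now rewrite gsub_add, gadd0 in period.
Qed.

Lemma almost_period_opp e t : almost_period e t -> almost_period e (gopp t).
Proof.
intros period. apply translate_dist_opp in period.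
now replace (gopp gzero) with (@gzero G) in period by abel.
Qed.

Variables (L : G -> Prop) (x0 : G).
Hypothesis L_flc : finite_local_complexity G L.
Hypothesis w_support : forall x, ~ L x -> w x = 0.
Hypothesis w_pos : 0 < w x0.
Hypothesis w_sup_ap : sup_ap G w.

Lemma positive_weight_in x : 0 < w x -> L x.
Proof. intros wx_pos. apply (nonzero_weight_in L w); trivial. lra. Qed.

Lemma almost_period_moves_in t e : e < w x0 -> almost_period e t -> L (gadd x0 t).
Proof.
intros e_lt period. specialize (period x0). unfold translate in period.
rewrite gadd_zero_r in period. apply Rabs_le_inv in period. apply positive_weight_in. lra.
Qed.

Lemma almost_period_in_diffset t e : e < w x0 -> almost_period e t -> diffset G L t.
Proof.
intros e_lt period. exists (gadd x0 t), x0. repeat split.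
- now apply almost_period_moves_in with e.
- now apply positive_weight_in.
- abel.
Qed.

Lemma almost_periods_mod_compact e : 0 < e ->
  exists K, is_compact (gopen G) K /\
    forall g, exists k, K k /\ almost_period e (gsub g k).
Proof.
intros e_pos. destruct (w_sup_ap e e_pos) as (K & compK & dense). exists K. split; trivial.
intros g. destruct (dense g) as (s & k & (r & r_lt & close) & Kk & ->).
exists k. split; trivial. replace (gsub (gadd s k) k) with s by abel. intros x.
unfold translate. rewrite (gaddC G x s), gadd_zero_r. specialize (close x). lra.
Qed.

Lemma hull_ball_totally_bounded (u : hull) r :
  r < w x0 -> uniformly_totally_bounded G in_hull (fun v : hull => sup_dist_le u v r).
Proof.
intros r_lt e e_pos. set (d := Rmin (e / 2) ((w x0 - r) / 4)).
assert (d_pos : 0 < d) by (apply Rmin_glb_lt; lra).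
assert (d_le : d <= e / 2 /\ d <= (w x0 - r) / 4) by (split; [apply Rmin_l|apply Rmin_r]).
destruct (hull_approx u d d_pos) as [t ut].
destruct (almost_periods_mod_compact d d_pos) as (K & compK & periods).
destruct (L_flc K compK) as [l listed].
exists (map (fun k => translate (gadd k t)) l). intros v uv.
destruct (hull_approx v d d_pos) as [s vs].
destruct (periods (gsub s t)) as (k & Kk & period).
assert (vk : sup_dist_le v (translate (gadd k t)) (d + d)).
{ apply sup_dist_le_trans with (translate s); trivial. apply translates_of_almost_period.
  now replace (gsub s (gadd k t)) with (gsub (gsub s t) k) by abel. }
exists (translate (gadd k t)). split; [|now apply (sup_dist_le_weaken _ _ (d + d)); [lra|]].
apply (in_map (fun k => translate (gadd k t))), listed; trivial.
apply almost_period_in_diffset with ((d + d) + (r + d)); [lra|].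
replace k with (gsub (gadd k t) t) by abel. apply almost_period_of_translates.
apply sup_dist_le_triangle_l with v; trivial.
apply sup_dist_le_triangle_l with u; trivial.
Qed.

Lemma hull_closed_ball_compact (u : hull) r :
  r < w x0 -> is_compact uniform_open (fun v : hull => sup_dist_le u v r).
Proof.
intros r_lt. apply closed_totally_bounded_compact.
- apply in_hull_closed.
- intros v near. apply sup_dist_le_limit. intros d d_pos.
  destruct (near d d_pos) as (z & uz & vz).
  apply sup_dist_le_trans with z; trivial. now apply sup_dist_le_sym.
- now apply hull_ball_totally_bounded.
Qed.

Lemma hull_locally_compact (u : hull) :
  exists U K, uniform_open U /\ U u /\ (forall z, U z -> K z) /\ is_compact uniform_open K.
Proof.
exists (uniform_ball u (w x0 / 2)), (fun v : hull => sup_dist_le u v (w x0 / 2)).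
repeat split.
- apply uniform_ball_open.
- apply uniform_ball_center. lra.
- intros v (r & r_lt & uv). apply (sup_dist_le_weaken _ _ r); trivial. lra.
- apply hull_closed_ball_compact. lra.
Qed.

Definition hull_group : LCAGroup :=
  mkLCA hull (hull_of gzero) hull_add hull_opp hull_addA hull_addC hull_add0 hull_addN
    uniform_open (uniform_open_full _ _) (uniform_open_inter _ _) (uniform_open_union _ _)
    hull_add_continuous hull_opp_continuous (uniform_hausdorff _ _) hull_locally_compact.

Definition hull_lattice (p : (G * hull_group)%type) : Prop := snd p = hull_of (fst p).

(* [u gzero] is the value at [u] of the continuous extension of the weights to
   the hull; adding its support makes the window fat without adding points. *)
Definition hull_window (u : hull_group) : Prop :=
  (exists x, L x /\ u = hull_of x) \/ 0 < value u gzero.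

Lemma hull_lattice_discrete : lattice_discrete G hull_group hull_lattice.
Proof.
destruct (locally_finite_isolated_zero _ L_flc) as (U & [openU U0] & isolated).
set (B := uniform_ball (hull_of gzero) (w x0)).
exists (fun p => U (fst p) /\ B (snd p)). split; [|split].
- intros p [Up Bp]. exists U, B. repeat split; trivial. apply uniform_ball_open.
- split; trivial. now apply uniform_ball_center.
- intros [x h] on_lattice [Ux (r & r_lt & near)]. unfold hull_lattice in on_lattice.
  simpl in on_lattice, Ux, near. subst h.
  assert (x = gzero); [|now subst x].
  apply isolated; trivial. apply almost_period_in_diffset with r; trivial.
  now apply sup_dist_le_sym.
Qed.

Lemma hull_lattice_cocompact : lattice_cocompact G hull_group hull_lattice.
Proof.
destruct (almost_periods_mod_compact (w x0 / 4)) as (K & compK & periods); [lra|].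
set (B := fun u : hull => sup_dist_le (hull_of gzero) u (w x0 / 2)).
exists (fun p : (G * hull_group)%type => K (fst p) /\ B (snd p)). split.
- apply (compact_prod G hull_group K B); trivial. apply hull_closed_ball_compact. lra.
- intros [g h]. destruct (hull_approx h (w x0 / 4)) as [t ht]; [lra|].
  destruct (periods (gsub g t)) as (k & Kk & period). set (y := gsub g k).
  exists (k, gsub h (hull_of y : hull_group)), (y, hull_of y).
  repeat split; simpl; trivial.
  + apply sup_dist_le_sym.
    replace (w x0 / 2) with ((w x0 / 4 + 0) + w x0 / 4) by field.
    apply sup_dist_le_trans with (translate (gadd t (gopp y))).
    * apply hull_add_approx; trivial. apply hull_opp_approx, hull_of_dist. lra.
    * apply almost_period_opp in period.
      replace (gopp (gsub (gsub g t) k)) with (gadd t (gopp y)) in period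
        by (unfold y; abel).
      exact period.
  + f_equal.
    * unfold y. abel.
    * symmetry. apply (@gsub_add hull_group).
Qed.

Lemma hull_window_approx (u : hull) e :
  hull_window u -> 0 < e -> exists x, L x /\ sup_dist_le u (translate x) e.
Proof.
intros [(x & Lx & ->)|u0_pos] e_pos.
- exists x. split; trivial. apply hull_of_dist. lra.
- destruct (hull_approx u (Rmin e (value u gzero / 2))) as [t ut].
  { apply Rmin_glb_lt; lra. }
  exists t. split; [|apply (sup_dist_le_weaken _ _ _ e) in ut; trivial; apply Rmin_l].
  specialize (ut gzero). unfold translate in ut. rewrite gadd0 in ut.
  apply Rabs_le_inv in ut. generalize (Rmin_r e (value u gzero / 2)). intros.
  apply positive_weight_in. lra.
Qed.

Lemma point_translates_net d : 0 < d -> d < w x0 ->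
  exists l, forall x, L x ->
    exists k, In k l /\ sup_dist_le (translate x) (translate k) d.
Proof.
intros d_pos d_lt.
destruct (almost_periods_mod_compact d d_pos) as (K & compK & periods).
destruct (L_flc K compK) as [l listed].
exists (map (gadd x0) l). intros x Lx.
destruct (periods (gsub x x0)) as (k & Kk & period). exists (gadd x0 k). split.
- apply in_map, listed; trivial. exists x, (gadd x0 (gsub (gsub x x0) k)).
  repeat split; trivial; [|abel]. now apply almost_period_moves_in with d.
- apply translates_of_almost_period.
  now replace (gsub x (gadd x0 k)) with (gsub (gsub x x0) k) by abel.
Qed.

Lemma hull_window_precompact :
  is_compact (gopen hull_group) (closure (gopen hull_group) hull_window).
Proof.
apply (closed_totally_bounded_compact G in_hull).
- apply in_hull_closed.
- intros u near U openU Uu. destruct (openU u Uu) as (e & e_pos & ball_e).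
  destruct (near e e_pos) as (v & closure_v & uv). apply (closure_v U openU). auto.
- intros e e_pos. set (d := Rmin (e / 4) (w x0 / 2)).
  assert (d_pos : 0 < d) by (apply Rmin_glb_lt; lra).
  assert (d_le : d <= e / 4 /\ d <= w x0 / 2) by (split; [apply Rmin_l|apply Rmin_r]).
  destruct (point_translates_net d) as [l net]; trivial; [lra|].
  exists (map translate l). intros u closure_u.
  destruct (closure_u (uniform_ball u (e / 2))) as (v & (r & r_lt & uv) & window_v).
  { apply uniform_ball_open. }
  { apply uniform_ball_center. lra. }
  destruct (hull_window_approx v (e / 4) window_v) as (x & Lx & vx); [lra|].
  destruct (net x Lx) as (k & In_k & xk). exists (translate k). split; [now apply in_map|].
  apply (sup_dist_le_weaken _ _ (r + (e / 4 + d))); [lra|].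
  apply sup_dist_le_trans with (value v); trivial.
  now apply sup_dist_le_trans with (translate x).
Qed.

Lemma hull_window_interior : has_nonempty_interior hull_group hull_window.
Proof.
exists (fun u : hull => 0 < value u gzero). split; [|split].
- intros u u0_pos. exists (value u gzero / 2). split; [lra|]. intros v uv.
  specialize (uv gzero). apply Rabs_le_inv in uv. lra.
- exists (hull_of x0). simpl. unfold translate. now rewrite gadd0.
- intros u u0_pos. now right.
Qed.

Definition is_period (t : G) : Prop := forall z, w (gadd t z) = w z.

Lemma is_period_subgroup : subgroup G is_period.
Proof.
repeat split.
- intros z. now rewrite gadd0.
- intros a b period_a period_b z. rewrite <- gaddA, period_a. auto.
- intros a period_a z. rewrite <- (period_a (gadd (gopp a) z)). f_equal. abel.
Qed.

Lemma is_period_in_diffset t : is_period t -> diffset G L t.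
Proof.
intros period_t. apply almost_period_in_diffset with 0; trivial. intros z. unfold translate.
rewrite (gaddC G z t), period_t, gadd_zero_r, Rminus_diag, Rabs_R0. lra.
Qed.

Lemma is_period_of_equal_translates x y : hull_of x = hull_of y -> is_period (gsub x y).
Proof.
intros E z. apply (f_equal (fun u => value u (gsub z y))) in E.
simpl in E. unfold translate in E. rewrite gsub_add in E. rewrite <- E. f_equal. abel.
Qed.

Hypothesis L_period_stable : period_stable G L.

Lemma point_of_hull_window x : hull_window (hull_of x) -> L x.
Proof.
intros [(y & Ly & E)|x_pos].
- destruct (L_period_stable is_period is_period_subgroup is_period_in_diffset) as [stable _].
  rewrite <- (gsub_add x y). apply stable; trivial. now apply is_period_of_equal_translates.
- apply positive_weight_in. simpl in x_pos. unfold translate in x_pos.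
  now rewrite gadd0 in x_pos.
Qed.

Lemma model_set_of_sup_ap : model_set G L.
Proof.
exists hull_group, hull_lattice, hull_window.
split; [reflexivity|].
split; [|split; [|split; [|split; [|split; [|split; [|split; [|split]]]]]]].
- intros [x u] [y v] on_lattice_u on_lattice_v. unfold hull_lattice in *. simpl in *.
  rewrite on_lattice_u, on_lattice_v. apply hull_of_add.
- intros [x u] on_lattice. unfold hull_lattice in *. simpl in *.
  rewrite on_lattice. apply hull_of_opp.
- apply hull_lattice_discrete.
- apply hull_lattice_cocompact.
- intros [x u] [y v] on_lattice_u on_lattice_v E. unfold hull_lattice in *. simpl in *.
  congruence.
- intros V openV [u Vu]. destruct (openV u Vu) as (e & e_pos & ball_e).
  destruct (hull_approx u e e_pos) as [t ut]. exists (t, hull_of t).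
  split; [reflexivity|]. now apply ball_e.
- apply hull_window_precompact.
- apply hull_window_interior.
- intros x. split.
  + intros Lx. exists (hull_of x). split; [reflexivity|]. left. now exists x.
  + intros (h & on_lattice & window_h). unfold hull_lattice in on_lattice.
    simpl in on_lattice. subst h. now apply point_of_hull_window.
Qed.
End Hull.

(** * The equivalences *)

Lemma carries_measure_impl {G : LCAGroup} (L : G -> Prop) (P Q : (G -> R) -> Prop) :
  (forall w, (forall x, 0 <= w x) -> (forall x, ~ L x -> w x = 0) -> nonzero_measure G w ->
     P w -> Q w) ->
  carries_measure G L P -> carries_measure G L Q.
Proof.
intros PQ (w & below & nonzero & Pw). exists w. repeat split; try apply below; trivial.
apply PQ; trivial; apply below.
Qed.

Lemma model_set_iff_sup_ap {G : LCAGroup} (L : G -> Prop) :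
  period_stable G L ->
  model_set G L <-> finite_local_complexity G L /\ carries_measure G L (sup_ap G).
Proof.
intros stable. split.
- intros model. split; [now apply model_set_flc|now apply model_set_carries_sup_ap].
- intros (flc & w & (w_ge0 & _ & support) & [x w_neq0] & sap).
  apply (model_set_of_sup_ap G w L x); trivial. specialize (w_ge0 x). lra.
Qed.

Theorem theorem10p2 (G : LCAGroup) (L : G -> Prop) (K : G -> Prop) :
  sigma_compact G ->
  is_compact (gopen G) K -> has_nonempty_interior G K ->
  relatively_dense G L -> period_stable G L ->
  let i := model_set G L in
  let ii := finite_local_complexity G L /\
            exists w, pos_measure_below_delta G L w /\ nonzero_measure G w /\ sup_ap G w in
  let iii := finite_local_complexity G L /\
            exists w, pos_measure_below_delta G L w /\ nonzero_measure G w /\ norm_ap G K w in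
  let iv := uniformly_discrete G (diffset G L) /\
            exists w, pos_measure_below_delta G L w /\ nonzero_measure G w /\ strongly_ap G w in
  (i <-> ii) /\ (ii <-> iii) /\ (iii <-> iv).
Proof.
intros _ compK (Q & _ & [k Qk] & QK) _ stable i ii iii iv.
assert (i_iff_ii : i <-> ii) by now apply model_set_iff_sup_ap.
assert (ii_iff_iii : ii <-> iii).
{ split; intros [flc carries]; (split; [exact flc|]);
    apply (carries_measure_impl L) with (2 := carries); intros w _ support _.
  - apply (norm_ap_of_sup_ap L); trivial.
    + now apply compact_totally_bounded.
    + now apply flc_uniformly_discrete.
  - apply (sup_ap_of_norm_ap K w k). auto. }
assert (ii_iff_iv : ii <-> iv).
{ split.
  - intros ii_holds. split; [now apply model_set_diffset_uniformly_discrete, i_iff_ii|].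
    destruct ii_holds as [flc carries].
    apply (carries_measure_impl L) with (2 := carries). intros w _ support _.
    apply (strongly_ap_of_sup_ap L); trivial. now apply flc_uniformly_discrete.
  - intros [udLL carries]. split; [now apply uniformly_discrete_locally_finite|].
    apply (carries_measure_impl L) with (2 := carries). intros w w_ge0 support nonzero.
    now apply (sup_ap_of_strongly_ap L). }
tauto.
Qed.
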